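(* Let $\hat\Theta=\Theta\wedge\epsilon\in\Lambda^6\mathbb{R}^{10}$ be the lift to ten dimensions of the $\mathfrak{spin}(7)$-invariant four-form $\Theta$ on $\mathbb{R}^8$, where $\epsilon$ is the volume form of $\mathbb{R}^2\subset\mathbb{R}^{10}=\mathbb{R}^8\oplus\mathbb{R}^2$. With respect to the decomposition $$\Lambda^5\mathbb{R}^{10}=\Lambda^5\mathbb{R}^8\ \oplus\ \Lambda^4\mathbb{R}^8\otimes\mathbb{R}^2\ \oplus\ \Lambda^3\mathbb{R}^8\otimes\Lambda^2\mathbb{R}^2$$ the operator $b_{\hat\Theta}:\Lambda^5\mathbb{R}^{10}\to\Lambda^5\mathbb{R}^{10}$ is given by $$b_{\hat\Theta}=\begin{pmatrix}0&0&6\,\tilde d_\Theta\otimes *\\ 0&\frac95\,b_\Theta\otimes *&0\\ \frac{3}{10}\,d_\Theta\otimes *&0&0\end{pmatrix}.$$ The eigenvalues of $b_{\hat\Theta}$ (on the complexification), its eigenspaces and their dimensions are as follows, where upper and lower signs correspond: - $0$: $\ \Lambda^4_{(0)}\mathbb{R}^8\otimes\mathbb{R}_+\oplus\Lambda^4_{(0)}\mathbb{R}^8\otimes\mathbb{R}_-$, of dimension $35+35=70$; - $\pm\frac{36}{5}i$: $\ \Lambda^4_{(-4)}\mathbb{R}^8\otimes\mathbb{R}_\mp$, of dimension $1$ each; - $\pm\frac{18}{5}i$: $\ \big\{\big(\mp\frac53 i\,\tilde d_\Theta(F),\,F\wedge\epsilon\big)\,:\,F\in\Lambda^3_{(-4)}\mathbb{R}^8\big\}\oplus\Lambda^4_{(-2)}\mathbb{R}^8\otimes\mathbb{R}_\mp$,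 of dimension $8+7$ each; - $\pm\frac65 i$: $\ \Lambda^4_{(\frac23)}\mathbb{R}^8\otimes\mathbb{R}_\pm$, of dimension $27$ each; - $\pm\frac35 i$: $\ \big\{\big(\mp10\,i\,\tilde d_\Theta(F),\,F\wedge\epsilon\big)\,:\,F\in\Lambda^3_{(\frac23)}\mathbb{R}^8\big\}$, of dimension $48$ each. Here a pair $(x,F\wedge\epsilon)$ lies in $\Lambda^5\mathbb{R}^8\oplus\Lambda^3\mathbb{R}^8\otimes\Lambda^2\mathbb{R}^2$.
   Context: Euclidean $\mathbb{R}^{10}=\mathbb{R}^8\oplus\mathbb{R}^2$ has orthonormal basis $e_1,\ldots,e_{10}$, with $\mathbb{R}^8=\mathrm{span}\{e_1,\ldots,e_8\}$, $\mathbb{R}^2=\mathrm{span}\{e_9,e_{10}\}$, $\epsilon=e_9\wedge e_{10}$. Indices are raised with the metric, repeated indices are summed, square brackets denote weight-one antisymmetrization, and wedge products use the convention $(\alpha\wedge\beta)_{a_1\ldots a_{p+q}}=\binom{p+q}{p}\alpha_{[a_1\ldots a_p}\beta_{a_{p+1}\ldots a_{p+q}]}$. $\Theta\in\Lambda^4\mathbb{R}^8$ has totally antisymmetric components determined by $\Theta_{ijkl}=1$ for $(ijkl)=(1245),(1276),(1346),(1357),(2356),(2437),(4567),(1238),(4358),(4718),(5168),(5728),(6248),(6738)$, all components with index sets not listed being zero; $\mathfrak{spin}(7)\subset\mathfrak{so}(8)$ is its stabilizer. The operator on ten-dimensional five-forms is $b_{\hat\Theta}(F)_{lmnop}=\hat\Theta_{ijk[lmn}F^{ijk}{}_{op]}$.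 On $\mathbb{R}^8$: $b_\Theta(F)_{lmn}=\Theta_{ij[lm}F^{ij}{}_{n]}$ for $F\in\Lambda^3\mathbb{R}^8$, and $b_\Theta(F)_{ijkl}=\Theta^{mn}{}_{[ij}F_{kl]mn}$ for $F\in\Lambda^4\mathbb{R}^8$; $\Lambda^k_{(\beta)}\mathbb{R}^8$ is the $\beta$-eigenspace of $b_\Theta$ on $\Lambda^k\mathbb{R}^8$ (complexified where needed). Further, $d_\Theta:\Lambda^5\mathbb{R}^8\to\Lambda^3\mathbb{R}^8$, $d_\Theta(F)_{lmn}=\Theta_{ijk[l}F^{ijk}{}_{mn]}$, and $\tilde d_\Theta:\Lambda^3\mathbb{R}^8\to\Lambda^5\mathbb{R}^8$, $\tilde d_\Theta(F)_{jklmn}=\Theta_{i[jkl}F^i{}_{mn]}$. The second tensor factor $*$ is the Hodge operator of $\mathbb{R}^2$: $*1=\epsilon$, $*\epsilon=1$, $*e_9=e_{10}$, $*e_{10}=-e_9$. Elements $F\otimes V$ with $F\in\Lambda^{p}\mathbb{R}^8$, $V\in\Lambda^q\mathbb{R}^2$ are identified with $F\wedge V$; the matrix acts on column vectors of the three summands in the order written. $\mathbb{R}_\pm\subset\mathbb{R}^2\otimes\mathbb{C}$ is the $\pm i$-eigenspace of $*$ on $\mathbb{R}^2$. *)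

(* Defs.v *)
From HB Require Import structures.
From mathcomp Require Import all_boot all_order all_fingroup all_algebra.
From mathcomp Require Import reals.
From mathcomp Require Import complex.
Set Implicit Arguments.
Unset Strict Implicit.
Unset Printing Implicit Defensive.
Import Order.TTheory GRing.Theory Num.Theory.
Local Open Scope ring_scope.

(* A k-form on K^n is the array of its components F_{a_1...a_k} in the standard
   orthonormal basis, so that raised and lowered indices coincide.  The basis
   vector e_{a+1} has index a : 'I_n.  Taking K := R[i] instead of K := R gives
   the complexified spaces, with the operators extended complex-linearly. *)

Section Forms.
Variable K : numFieldType.

Definition tensor (n k : nat) := {ffun k.-tuple 'I_n -> K^o}.
HB.instance Definition _ n k := Vector.copy (tensor n k) {ffun k.-tuple 'I_n -> K^o}.

Definition permute n k (s : 'S_k) (t : k.-tuple 'I_n) : k.-tuple 'I_n :=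
  [tuple tnth t (s i) | i < k].

Definition asym_defect n k (s : 'S_k) (F : tensor n k) : tensor n k :=
  [ffun t => F (permute s t) - (-1) ^+ s * F t].

Fact asym_defect_linear n k (s : 'S_k) : linear (@asym_defect n k s).
Proof.
move=> a F G; apply/ffunP=> t; rewrite !ffunE /GRing.scale /=.
by rewrite mulrDr mulrCA mulrBr opprD addrACA.
Qed.
HB.instance Definition _ n k (s : 'S_k) :=
  GRing.isLinear.Build K (tensor n k) (tensor n k) _ (@asym_defect n k s)
    (asym_defect_linear s).

Definition asymv n k : {vspace tensor n k} :=
  (\bigcap_(s : 'S_k) lker (linfun (@asym_defect n k s)))%VS.

Lemma asymvP n k (F : tensor n k) :
  reflect (forall (s : 'S_k) t, F (permute s t) = (-1) ^+ s * F t)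
          (F \in asymv n k).
Proof.
rewrite /asymv memvE; apply: (iffP subv_bigcapP) => [FP s t | FP s _].
  have := FP s isT; rewrite -memvE memv_ker lfunE /= => /eqP/ffunP/(_ t).
  by rewrite !ffunE => /eqP; rewrite subr_eq0 => /eqP.
rewrite -memvE memv_ker lfunE /=; apply/eqP/ffunP => t.
by rewrite !ffunE FP subrr.
Qed.

Definition kform (n k : nat) := subvs_of (asymv n k).
HB.instance Definition _ n k := Vector.copy (kform n k) (subvs_of (asymv n k)).

Definition component n k (F : kform n k) : k.-tuple 'I_n -> K := fun t => vsval F t.
Coercion component : kform >-> Funclass.

Lemma formP n k (F G : kform n k) : (forall t, F t = G t) -> F = G.
Proof. by move=> FG; apply/val_inj/ffunP. Qed.

Lemma componentD n k (F G : kform n k) t : (F + G : kform n k) t = F t + G t.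
Proof. by rewrite /component /= ffunE. Qed.

Lemma componentZ n k (a : K) (F : kform n k) t : (a *: F : kform n k) t = a * F t.
Proof. by rewrite /component /= ffunE. Qed.

(* Weight-one antisymmetrization f_{[a_1...a_k]}. *)
Definition asym_tensor n k (f : k.-tuple 'I_n -> K) : tensor n k :=
  [ffun t => (k`!)%:R^-1 * \sum_(s : 'S_k) (-1) ^+ s * f (permute s t)].

Fact asym_tensor_mem n k (f : k.-tuple 'I_n -> K) :
  asym_tensor f \in asymv n k.
Proof.
apply/asymvP => s t; rewrite !ffunE mulrCA; congr (_ * _).
rewrite big_distrr /= [RHS](reindex_inj (mulIg s)); apply: eq_bigr => u _ /=.
rewrite odd_permM signr_addb mulrA [_ * (_ * (-1) ^+ s)]mulrCA -expr2 sqrr_sign.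
rewrite mulr1; congr (_ * f _); apply: eq_from_tnth => i.
by rewrite !tnth_mktuple permM.
Qed.

Definition antisym n k (f : k.-tuple 'I_n -> K) : kform n k :=
  Subvs (asym_tensor_mem f).

Lemma antisymE n k (f : k.-tuple 'I_n -> K) t :
  antisym f t = (k`!)%:R^-1 * \sum_(s : 'S_k) (-1) ^+ s * f (permute s t).
Proof. by rewrite /component ffunE. Qed.

Lemma antisym_linear (V : lmodType K) n k (f : V -> k.-tuple 'I_n -> K) :
  (forall a u v t, f (a *: u + v) t = a * f u t + f v t) ->
  linear (fun v => antisym (f v)).
Proof.
move=> fL a u v; apply: formP => t; rewrite componentD componentZ !antisymE.
rewrite mulrCA -mulrDr; congr (_ * _); rewrite big_distrr -big_split /=.
by apply: eq_bigr => s _; rewrite fL mulrDr mulrCA.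
Qed.

Lemma antisym_id n k (F : kform n k) : antisym F = F.
Proof.
apply: formP => t; rewrite antisymE.
rewrite (eq_bigr (fun=> F t)) => [|s _].
  rewrite sumr_const card_Sn -[F t *+ _]mulr_natl mulrA mulVf ?mul1r //.
  by rewrite pnatr_eq0 -lt0n fact_gt0.
have /= -> : F (permute s t) = _ := asymvP _ (subvsP F) s t.
by rewrite mulrA -expr2 sqrr_sign mul1r.
Qed.

Definition wedge n p q (a : kform n p) (b : kform n q) : kform n (p + q) :=
  'C(p + q, p)%:R *: antisym (fun t : (p + q).-tuple 'I_n =>
    a [tuple tnth t (lshift q i) | i < p] *
    b [tuple tnth t (rshift p i) | i < q]).

Definition one n : kform n 0 := antisym (fun=> 1).

Definition e n (a : 'I_n) : kform n 1 := antisym (fun t => (thead t == a)%:R).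

Lemma oneE n t : one n t = 1.
Proof.
rewrite antisymE (eq_bigr (fun=> 1)) => [|s _].
  by rewrite sumr_const card_Sn invr1 mul1r.
by rewrite (_ : s = 1%g) ?odd_perm1 ?mulr1 //; apply/permP => - [].
Qed.

Lemma eE n (a b : 'I_n) : e a [tuple b] = (b == a)%:R.
Proof.
rewrite antisymE (eq_bigr (fun=> (b == a)%:R)) => [|s _].
  by rewrite sumr_const card_Sn invr1 mul1r.
rewrite (_ : s = 1%g) ?odd_perm1 ?mul1r.
  by rewrite /thead tnth_mktuple perm1 (tnth_nth b).
by apply/permP => i; rewrite !ord1.
Qed.

(* The inclusion of forms induced by sending the basis vector of index a to the
   basis vector of index h a: components with an index outside the range of h
   vanish. *)
Definition push m n k (h : 'I_m -> 'I_n) (F : kform m k) : kform n k :=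
  antisym (fun t => \sum_(u : k.-tuple 'I_m | map_tuple h u == t) F u).

Lemma pushE m n k (h : 'I_m -> 'I_n) (F : kform m k) (u : k.-tuple 'I_m) :
  injective h -> push h F (map_tuple h u) = F u.
Proof.
move=> h_inj; rewrite antisymE -[in RHS](antisym_id F) antisymE.
congr (_ * _); apply: eq_bigr => s _; congr (_ * _).
rewrite (bigD1 (permute s u)) /=; last first.
  by apply/eqP/eq_from_tnth => i; rewrite !(tnth_map, tnth_mktuple).
rewrite big1 ?addr0 // => v /andP[/eqP hv /eqP[]].
apply: eq_from_tnth => i; apply: h_inj.
by have := congr1 (fun t => tnth t i) hv; rewrite !(tnth_map, tnth_mktuple).
Qed.

(* K^8 and K^2 sit in K^10 as the first eight and the last two coordinates, and
   F \ox V is identified with the form F /\ V.  Accordingly the tensor product of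
   two spaces of forms is the span of these products; since q-forms on K^2 with
   q = 0 are scalars, F \ox one 2 is F itself seen on K^10. *)
Definition otimes p q (F : kform 8 p) (V : kform 2 q) : kform 10 (p + q) :=
  wedge (push (@lshift 8 2) F) (push (@rshift 8 2) V).

Definition otimesv p q (U : {vspace kform 8 p}) (W : {vspace kform 2 q}) :
    {vspace kform 10 (p + q)} :=
  <<[seq otimes F V | F <- vbasis U, V <- vbasis W]>>%VS.

Definition otimesr_fun p q (V : kform 2 q) (F : kform 8 p) : kform 10 (p + q) :=
  otimes F V.

Fact otimesr_linear p q (V : kform 2 q) : linear (@otimesr_fun p q V).
Proof.
have pushL m n k (h : 'I_m -> 'I_n) : linear (@push m n k h).
  apply: antisym_linear => a u v t; rewrite big_distrr -big_split /=.
  by apply: eq_bigr => w _; rewrite componentD componentZ.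
move=> a F G; rewrite /otimesr_fun /otimes pushL /wedge scalerA mulrC -scalerA -scalerDr.
congr (_ *: _); apply: (@antisym_linear (kform 10 p) _ _ (fun (F : kform 10 p) t =>
  F _ * push (@rshift 8 2) V _)) => {F G} b F G t.
by rewrite componentD componentZ mulrDl mulrA.
Qed.
HB.instance Definition _ p q (V : kform 2 q) :=
  GRing.isLinear.Build K (kform 8 p) (kform 10 (p + q)) _
    (@otimesr_fun p q V) (otimesr_linear V).

Definition otimesr p q (V : kform 2 q) : 'Hom(kform 8 p, kform 10 (p + q)) :=
  linfun (@otimesr_fun p q V).

Definition eps : kform 2 2 := wedge (e (0 : 'I_2)) (e (1 : 'I_2)).

Lemma epsE : eps [tuple 0; 1] = 1.
Proof.
rewrite componentZ antisymE mulrA divff ?pnatr_eq0 // mul1r.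
have tE (t : 1.-tuple 'I_2) : t = [tuple thead t].
  by apply: eq_from_tnth => i; rewrite !ord1.
pose t01 : 2.-tuple 'I_2 := [tuple 0; 1].
have t01E i : tnth t01 i = i.
  by apply: val_inj; case: i => - [|[|]] // ?; rewrite (tnth_nth 0).
rewrite (bigD1 (1%g : 'S_2)) //= odd_perm1 expr0 mul1r big1 => [|s s1].
  rewrite addr0 (tE [tuple _ | i < 1]) [X in e 1 X]tE !eE /thead !tnth_mktuple.
  by rewrite !perm1 -/t01 !t01E -[in X in X * _]val_eqE -[in X in _ * X]val_eqE /= mulr1.
rewrite (tE [tuple _ | i < 1]) [X in e 1 X]tE !eE /thead !tnth_mktuple -/t01 !t01E.
case: eqP => [s0|]; last by rewrite mul0r mulr0.
case: eqP => [s2|]; last by rewrite !mulr0.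
case/eqP: s1; apply/permP => i; rewrite perm1.
have [-> | ->] : i = 0 \/ i = 1.
  by case: i => - [|[|//]] ?; [left | right]; apply: val_inj.
- by rewrite -[RHS]s0; congr (s _); apply: val_inj.
- by rewrite -[RHS]s2; congr (s _); apply: val_inj.
Qed.

(* The Hodge operator of K^2 in degrees 0, 1 and 2. *)
Definition star0_fun (c : kform 2 0) : kform 2 2 := c [tuple] *: eps.
Definition star1_fun (V : kform 2 1) : kform 2 1 :=
  V [tuple 0] *: e 1 - V [tuple 1] *: e 0.
Definition star2_fun (W : kform 2 2) : kform 2 0 := W [tuple 0; 1] *: one 2.

Fact star0_linear : linear star0_fun.
Proof.
by move=> a F G; rewrite /star0_fun componentD componentZ scalerDl -scalerA.
Qed.
Fact star1_linear : linear star1_fun.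
Proof.
move=> a F G; rewrite /star1_fun !componentD !componentZ !scalerDl opprD.
by rewrite scalerBr !scalerA addrACA.
Qed.
Fact star2_linear : linear star2_fun.
Proof.
by move=> a F G; rewrite /star2_fun componentD componentZ scalerDl scalerA.
Qed.
HB.instance Definition _ := GRing.isLinear.Build K _ _ _ star0_fun star0_linear.
HB.instance Definition _ := GRing.isLinear.Build K _ _ _ star1_fun star1_linear.
HB.instance Definition _ := GRing.isLinear.Build K _ _ _ star2_fun star2_linear.

Lemma star_table :
  [/\ star0_fun (one 2) = eps, star2_fun eps = one 2,
      star1_fun (e 0) = e 1 & star1_fun (e 1) = - e 0].
Proof.
rewrite /star0_fun /star1_fun /star2_fun oneE epsE !eE !eqxx.
by rewrite !scale1r !scale0r subr0 sub0r.
Qed.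

Definition star0 : 'Hom(kform 2 0, kform 2 2) := linfun star0_fun.
Definition star1 : 'End(kform 2 1) := linfun star1_fun.
Definition star2 : 'Hom(kform 2 2, kform 2 0) := linfun star2_fun.

(* 1-based, as in Theta_{ijkl} = 1. *)
Definition Theta_indices : seq (seq nat) :=
  [:: [:: 1; 2; 4; 5]; [:: 1; 2; 7; 6]; [:: 1; 3; 4; 6]; [:: 1; 3; 5; 7];
      [:: 2; 3; 5; 6]; [:: 2; 4; 3; 7]; [:: 4; 5; 6; 7]; [:: 1; 2; 3; 8];
      [:: 4; 3; 5; 8]; [:: 4; 7; 1; 8]; [:: 5; 1; 6; 8]; [:: 5; 7; 2; 8];
      [:: 6; 2; 4; 8]; [:: 6; 7; 3; 8]]%N.

Definition Theta_listed (t : 4.-tuple 'I_8) : bool :=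
  [seq (nat_of_ord a).+1 | a <- t] \in Theta_indices.

(* The factor 4! undoes the weight of the antisymmetrization: see
   Theta_listedE below. *)
Definition Theta : kform 8 4 :=
  (4`!)%:R *: antisym (fun t => (Theta_listed t)%:R).

Lemma Theta_listedE (t : 4.-tuple 'I_8) : Theta_listed t -> Theta t = 1.
Proof.
move=> tL; rewrite componentZ antisymE mulrA divff ?pnatr_eq0 // mul1r.
have uL : all uniq Theta_indices by [].
have dL : all (fun u => all (fun v => perm_eq u v ==> (u == v)) Theta_indices)
              Theta_indices by vm_compute.
have sI : injective (fun a : 'I_8 => (nat_of_ord a).+1).
  by move=> a b [] /val_inj.
rewrite (bigD1 (1%g : 'S_4)) //= odd_perm1 expr0 mul1r.
have -> : permute 1 t = t by apply: eq_from_tnth => i; rewrite tnth_mktuple perm1.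
rewrite tL big1 ?addr0 // => s s1.
case: (boolP (Theta_listed (permute s t))) => [sL | _]; last by rewrite mulr0.
have pst : perm_eq (permute s t) t by apply/tuple_permP; exists s.
have /(allP (allP dL _ sL)) : [seq (nat_of_ord a).+1 | a <- t] \in Theta_indices by [].
rewrite perm_map // => /eqP/(inj_map sI)/val_inj est.
case/eqP: s1; apply/permP => i; rewrite perm1.
have ut : uniq t by rewrite -(map_inj_uniq sI); apply: (allP uL).
have /tuple_uniqP ti := ut; apply: ti.
by have := congr1 (fun u => tnth u i) est; rewrite tnth_mktuple.
Qed.

Lemma Theta_unlistedE (t : 4.-tuple 'I_8) :
  (forall s : 'S_4, ~~ Theta_listed (permute s t)) -> Theta t = 0.
Proof.
move=> tL; rewrite componentZ antisymE big1 ?mulr0 // => s _.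
by rewrite (negPf (tL s)) mulr0.
Qed.

Definition hatTheta : kform 10 6 := otimes Theta eps.

Definition b_hat_fun (F : kform 10 5) : kform 10 5 :=
  antisym (fun t => \sum_i \sum_j \sum_k
    hatTheta [tuple i; j; k; t`_0; t`_1; t`_2] * F [tuple i; j; k; t`_3; t`_4]).

Definition b3_fun (F : kform 8 3) : kform 8 3 :=
  antisym (fun t => \sum_i \sum_j
    Theta [tuple i; j; t`_0; t`_1] * F [tuple i; j; t`_2]).

Definition b4_fun (F : kform 8 4) : kform 8 4 :=
  antisym (fun t => \sum_m \sum_n
    Theta [tuple m; n; t`_0; t`_1] * F [tuple t`_2; t`_3; m; n]).

Definition d_fun (F : kform 8 5) : kform 8 3 :=
  antisym (fun t => \sum_i \sum_j \sum_k
    Theta [tuple i; j; k; t`_0] * F [tuple i; j; k; t`_1; t`_2]).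

Definition dt_fun (F : kform 8 3) : kform 8 5 :=
  antisym (fun t => \sum_i
    Theta [tuple i; t`_0; t`_1; t`_2] * F [tuple i; t`_3; t`_4]).

Let sumL (I : finType) a (f g h : I -> K) :
  (forall i, f i = a * g i + h i) ->
  \sum_i f i = a * (\sum_i g i) + \sum_i h i.
Proof.
by move=> E; rewrite big_distrr -big_split; apply: eq_bigr => i _; apply: E.
Qed.

Let mulL n k (c a : K) (F G : kform n k) t :
  c * (a *: F + G : kform n k) t = a * (c * F t) + c * G t.
Proof. by rewrite componentD componentZ mulrDr mulrCA. Qed.

Fact b_hat_linear : linear b_hat_fun.
Proof. by apply: antisym_linear => a F G t; do 3!apply: sumL => ?; apply: mulL. Qed.
Fact b3_linear : linear b3_fun.
Proof. by apply: antisym_linear => a F G t; do 2!apply: sumL => ?; apply: mulL. Qed.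
Fact b4_linear : linear b4_fun.
Proof. by apply: antisym_linear => a F G t; do 2!apply: sumL => ?; apply: mulL. Qed.
Fact d_linear : linear d_fun.
Proof. by apply: antisym_linear => a F G t; do 3!apply: sumL => ?; apply: mulL. Qed.
Fact dt_linear : linear dt_fun.
Proof. by apply: antisym_linear => a F G t; apply: sumL => ?; apply: mulL. Qed.
HB.instance Definition _ := GRing.isLinear.Build K _ _ _ b_hat_fun b_hat_linear.
HB.instance Definition _ := GRing.isLinear.Build K _ _ _ b3_fun b3_linear.
HB.instance Definition _ := GRing.isLinear.Build K _ _ _ b4_fun b4_linear.
HB.instance Definition _ := GRing.isLinear.Build K _ _ _ d_fun d_linear.
HB.instance Definition _ := GRing.isLinear.Build K _ _ _ dt_fun dt_linear.

Definition b_hat : 'End(kform 10 5) := linfun b_hat_fun.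
Definition b3 : 'End(kform 8 3) := linfun b3_fun.
Definition b4 : 'End(kform 8 4) := linfun b4_fun.
Definition d_Theta : 'Hom(kform 8 5, kform 8 3) := linfun d_fun.
Definition dt_Theta : 'Hom(kform 8 3, kform 8 5) := linfun dt_fun.

Definition Lambda3 (beta : K) : {vspace kform 8 3} := passmx.leigenspace b3 beta.
Definition Lambda4 (beta : K) : {vspace kform 8 4} := passmx.leigenspace b4 beta.

(* { (c dt_Theta(F), F /\ eps) : F in U } *)
Definition graph (c : K) (U : {vspace kform 8 3}) : {vspace kform 10 5} :=
  ((c *: (otimesr 5 (one 2) \o dt_Theta) + otimesr 3 eps) @: U)%VS.

End Forms.

Arguments b_hat {K}.
Arguments b3 {K}.
Arguments b4 {K}.
Arguments d_Theta {K}.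
Arguments dt_Theta {K}.
Arguments star0 {K}.
Arguments star1 {K}.
Arguments star2 {K}.

Notation "F \ox V" := (otimes F V) (at level 40, left associativity) : ring_scope.
Notation "U \ox W" := (otimesv U W) (at level 40, left associativity) : vspace_scope.

(* R_+ for s = false, R_- for s = true. *)
Definition R_pm (R : realType) (s : bool) : {vspace kform R[i] 2 1} :=
  passmx.leigenspace star1 ((-1) ^+ s * 'i%C).

(* Main.v *)
Require Import Defs.
From Stdlib Require Import ZArith.
From HB Require Import structures.
From mathcomp Require Import all_boot all_order all_fingroup all_algebra.
From mathcomp Require Import reals complex.
From mathcomp Require Import ring lra zify ssrZ.
Set Implicit Arguments.
Unset Strict Implicit.
Unset Printing Implicit Defensive.
Import Order.TTheory GRing.Theory Num.Theory.
Local Open Scope ring_scope.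

(** All operators of the statement are contractions
      F |-> Phi_{c_1...c_r [a_1...a_p} F_{c_1...c_r b_1...b_q]}
    with Phi alternating.  Antisymmetrization then reduces to a sum over
    (p, q)-shuffles and the contraction to a sum over increasing c, in which each
    of the 14 nonzero components of Theta contributes at most one c: the
    component of the image at an increasing index is an explicit short signed sum
    of components of F.  Comparing these sums for Theta /\ epsilon and for Theta
    gives the block form of b_hat.  In the same way the integer matrices M3 and M4
    of (3/2) b_Theta on Lambda^3 and 3 b_Theta on Lambda^4 satisfy
      (M3 + 6) (M3 - 1) = 0,   M4 (M4 + 12) (M4 + 6) (M4 - 2) = 0,
    and d_Theta o dt_Theta = (3/2) b_Theta - 6/5 on Lambda^3.  Multiples of the
    spectral projectors are polynomials in M3 and M4, and the trace of such a
    multiple gives its rank, hence a lower bound for the dimension of the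
    eigenspace.  The resulting subspaces of eigenvectors of b_hat have dimensions
    adding up to 252 = dim Lambda^5 R^10; as eigenspaces are independent, nothing
    else is left. *)

(** * Alternating functions of index sequences *)

(** Arithmetic in the real field and its complexification does not evaluate. Hence every fact about
    the fourteen components of Theta is kept as data over [nat], [bool] and [Z], settled by
    evaluation, and only then transported to an arbitrary numeric field [K]; the complex unit enters
    through i i = -1 alone. The factors 3/2 and 3 that make the spectra integral undo the weights 2!
    1! 2! / 3! = 2/3 and 2! 2! 2! / 4! = 1/3 of the antisymmetrized contractions.

    The block form spares a spectral computation in dimension 252. On the middle block the operator
    is a tensor product, with eigenvalues 9/5 beta times the eigenvalue of the Hodge operator. On
    the outer blocks the ansatz (c dt F, F) with F in Lambda^3_(beta) turns the eigenvector equation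
    into x c = 6 and (3/10) c (3/2 beta - 6/5) = x, so c^2 = 20 / (3/2 beta - 6/5). This is -25/9
    for beta = -4 and -100 for beta = 2/3, whence the imaginary constants 5/3 i and 10 i. *)

Section Alternating.
Variable K : numFieldType.
Implicit Types (f : seq nat -> K) (g : seq nat -> seq nat -> K) (s t u v : seq nat).

(** Only adjacent exchanges are mentioned, on untyped lists: the property then survives fixing a
    prefix, and inductions on lists go through without permutations. *)
Definition alternating f :=
  forall u x y v, f (u ++ x :: y :: v) = - f (u ++ y :: x :: v).

Lemma alternating_cons f x : alternating f -> alternating (fun s => f (x :: s)).
Proof. by move=> fA u y z v; rewrite -!cat_cons fA. Qed.

Lemma alternating_cat f w : alternating f -> alternating (fun s => f (w ++ s)).
Proof. by move=> fA u y z v; rewrite !catA fA. Qed.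

Lemma alternating_move f x u v : alternating f ->
  f (u ++ x :: v) = (-1) ^+ size u * f (x :: u ++ v).
Proof.
elim: u f => [|y u IHu] f fA /=; first by rewrite mul1r.
rewrite (IHu (fun s => f (y :: s)) (alternating_cons _ fA)).
by rewrite (fA [::]) /= exprS mulrN mulN1r mulNr.
Qed.

(** The repeated entry is moved next to its twin, where exchanging equal neighbours gives f = -
    f. *)
Lemma alternating_repeat f s : alternating f -> ~~ uniq s -> f s = 0.
Proof.
elim: s f => [|x s IHs] f fA //=; rewrite negb_and negbK => /orP[xs | us].
  case/splitPr: xs => u v; rewrite -cat_cons (alternating_move x (x :: u)) //.
  suff -> : f (x :: x :: u ++ v) = 0 by rewrite mulr0.
  by apply/eqP; rewrite -eqNr -(fA [::]).
exact: (IHs (fun s => f (x :: s)) (alternating_cons _ fA)).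
Qed.

(* [None] stands for a repeated index, where an alternating function vanishes. *)
Fixpoint signed_insert (x : nat) s : option (bool * seq nat) :=
  if s is y :: s' then
    if (x < y)%N then Some (false, x :: s) else
    if x == y then None else
    omap (fun r => (~~ r.1, y :: r.2)) (signed_insert x s')
  else Some (false, [:: x]).

Fixpoint signed_sort s : option (bool * seq nat) :=
  if s is x :: s' then
    obind (fun r => omap (fun r' => (r.1 (+) r'.1, r'.2)) (signed_insert x r.2))
          (signed_sort s')
  else Some (false, [::]).

Lemma signed_insertE f x s : alternating f ->
  f (x :: s) = if signed_insert x s is Some r then (-1) ^+ r.1 * f r.2 else 0.
Proof.
elim: s f => [|y s IHs] f fA /=; first by rewrite mul1r.
case: ltnP => [_ | _] /=; first by rewrite mul1r.
case: eqP => [-> | _] /=.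
  by rewrite alternating_repeat //= inE eqxx.
rewrite (fA [::]) /= (IHs (fun s => f (y :: s)) (alternating_cons _ fA)).
by case: (signed_insert x s) => [[b r]|] /=; rewrite ?oppr0 // signrN mulNr.
Qed.

Lemma signed_sortE f s : alternating f ->
  f s = if signed_sort s is Some r then (-1) ^+ r.1 * f r.2 else 0.
Proof.
elim: s f => [|x s IHs] f fA /=; first by rewrite mul1r.
rewrite (IHs (fun s => f (x :: s)) (alternating_cons _ fA)).
case: (signed_sort s) => [[b r]|] //=.
rewrite (signed_insertE _ _ fA); case: (signed_insert x r) => [[c t]|] /=.
  by rewrite mulrA signr_addb.
by rewrite mulr0.
Qed.

Lemma signed_insert_perm x s r : signed_insert x s = Some r ->
  perm_eq r.2 (x :: s).
Proof.
elim: s r => [|y s IHs] r /=; first by case=> <-.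
case: ltnP => _; first by case=> <-.
case: eqP => // _; case E: (signed_insert x s) => [r'|] //= [<-] /=.
apply: perm_trans (_ : perm_eq (y :: x :: s) _); first by rewrite perm_cons IHs.
exact/permPl/(perm_catCA [:: y] [:: x]).
Qed.

Lemma signed_sort_perm s r : signed_sort s = Some r -> perm_eq r.2 s.
Proof.
elim: s r => [|x s IHs] r /=; first by case=> <-.
case E: (signed_sort s) => [q|] //=.
case E': (signed_insert x q.2) => [q'|] //= [<-] /=.
by apply: perm_trans (signed_insert_perm E') _; rewrite perm_cons IHs.
Qed.

Lemma signed_insert_sorted x s r : sorted ltn s -> signed_insert x s = Some r ->
  sorted ltn r.2.
Proof.
elim: s r => [|y s IHs] r /=; first by move=> _ [<-].
case: ltnP => [xy | yx] ys; first by case=> <- /=; rewrite xy.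
case: eqP => // nxy; case E: (signed_insert x s) => [q|] //= [<-] /=.
rewrite path_min_sorted ?(IHs _ (path_sorted ys) E) //.
rewrite (perm_all _ (signed_insert_perm E)) /= ltn_neqAle yx eq_sym.
by rewrite (introN eqP nxy) /= (order_path_min ltn_trans ys).
Qed.

Lemma signed_sort_sorted s r : signed_sort s = Some r -> sorted ltn r.2.
Proof.
elim: s r => [|x s IHs] r /=; first by case=> <-.
case E: (signed_sort s) => [q|] //=.
case E': (signed_insert x q.2) => [q'|] //= [<-] /=.
exact: signed_insert_sorted (IHs _ E) E'.
Qed.

Lemma signed_insert_uniq x s : x \notin s -> signed_insert x s <> None.
Proof.
elim: s => [|y s IHs] //=; rewrite inE negb_or => /andP[/negPf-> /IHs].
by case: ltnP => // _; case: (signed_insert x s).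
Qed.

Lemma signed_sort_uniq s : uniq s -> signed_sort s <> None.
Proof.
elim: s => [|x s IHs] //= /andP[xs /IHs].
case E: (signed_sort s) => [q|] //= _.
have: x \notin q.2 by rewrite (perm_mem (signed_sort_perm E)).
by move=> /signed_insert_uniq; case: (signed_insert x q.2).
Qed.

Lemma perm_sorted_ltn s t : sorted ltn s -> sorted ltn t -> perm_eq s t -> s = t.
Proof.
by move=> ss st /perm_mem st'; apply: (irr_sorted_eq ltn_trans ltnn).
Qed.

Lemma signed_sort_perm_sorted s t : sorted ltn t -> perm_eq s t ->
  exists b : bool, signed_sort s = Some (b, t).
Proof.
move=> st pst; have us : uniq s.
  by rewrite (perm_uniq pst) (sorted_uniq ltn_trans ltnn).
have := signed_sort_uniq us; case E: (signed_sort s) => [[b r]|] // _.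
exists b; congr (Some (_, _)); apply: perm_sorted_ltn => //.
  exact: signed_sort_sorted E.
exact: perm_trans (signed_sort_perm E) pst.
Qed.

End Alternating.

(** * Sums over permutations and shuffles *)

(* The boolean is the parity of the shuffle sending s to the two parts. *)
Fixpoint splits (p : nat) (s : seq nat) : seq (bool * (seq nat * seq nat)) :=
  if s is x :: s' then
    (if p is p'.+1 then
       [seq (z.1, (x :: z.2.1, z.2.2)) | z <- splits p' s'] else [::]) ++
    [seq (z.1 (+) odd p, (z.2.1, x :: z.2.2)) | z <- splits p s']
  else if p is 0 then [:: (false, ([::], [::]))] else [::].

Lemma splits_small p s : (size s < p)%N -> splits p s = [::].
Proof.
elim: s p => [|x s IHs] [|p] //= sp; rewrite !IHs //.
exact: ltnW.
Qed.

Section Shuffle.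
Variable K : numFieldType.
Implicit Types (f : seq nat -> K) (g : seq nat -> seq nat -> K) (s t u v : seq nat).

(** The signed sum over all rearrangements, organised for induction: the head is inserted at each
    position [i] of a rearranged tail, passing [i] entries. *)
Fixpoint alternating_sum f s : K :=
  if s is x :: s' then
    \sum_(i < size s) (-1) ^+ i *
      alternating_sum (fun r => f (take i r ++ x :: drop i r)) s'
  else f [::].

Definition shuffle_sum g p s :=
  \sum_(z <- splits p s) (-1) ^+ z.1 * g z.2.1 z.2.2.

Lemma eq_alternating_sum f f' s :
  (forall r, size r = size s -> f r = f' r) ->
  alternating_sum f s = alternating_sum f' s.
Proof.
elim: s f f' => [|x s IHs] f f' ff' /=; first exact: ff'.
apply: eq_bigr => i _; congr (_ * _); apply: IHs => r rs; apply: ff'.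
by rewrite size_cat /= addnS -size_cat cat_take_drop rs.
Qed.

Lemma alternating_sumZ c f s :
  alternating_sum (fun r => c * f r) s = c * alternating_sum f s.
Proof.
elim: s f => [|x s IHs] f //=; rewrite big_distrr; apply: eq_bigr => i _ /=.
by rewrite IHs mulrCA.
Qed.

(** A head assigned to the second part must pass the [p] entries still destined for the first part;
    this is the sign (-1)^p. *)
Lemma shuffle_sum_cons g p x s :
  shuffle_sum g p (x :: s) =
    (if p is p'.+1 then shuffle_sum (fun a b => g (x :: a) b) p' s else 0) +
    (-1) ^+ p * shuffle_sum (fun a b => g a (x :: b)) p s.
Proof.
rewrite /shuffle_sum /= big_cat /=; congr (_ + _).
  by case: p => [|p]; rewrite ?big_nil // big_map.
rewrite big_map big_distrr /=; apply: eq_bigr => z _ /=.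
by rewrite signr_addb signr_odd mulrA [_ * (-1) ^+ z.1]mulrC.
Qed.

(** Permutations are sorted by the preimage [i] of 0, which is the position where the head of the
    list lands. Injectivity and the count (n+1) n! = (n+1)! give the bijection. *)
Lemma sum_perm_lift n (F : 'S_n.+1 -> K) :
  \sum_s F s = \sum_i \sum_(s : 'S_n) F (lift_perm i ord0 s).
Proof.
pose h (z : 'I_n.+1 * 'S_n) := lift_perm z.1 ord0 z.2.
have h_inj : injective h.
  move=> [i s] [j t] /permP; rewrite /h /= => e.
  have ij : i = j.
    have := e i; rewrite lift_perm_id -{1}(lift_perm_id j ord0 t).
    by move/perm_inj.
  rewrite ij in e *; congr (_, _); apply/permP => k.
  by have := e (lift j k); rewrite !lift_perm_lift => /lift_inj.
have h_bij : bijective h.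
  apply: inj_card_bij => //.
  by rewrite card_prod card_ord !card_Sn factS.
by rewrite (reindex h (onW_bij _ h_bij)) pair_big.
Qed.

Lemma alternating_sum_perm f s k : size s = k ->
  \sum_(p : 'S_k) (-1) ^+ p * f [seq nth 0%N s (p i) | i <- enum 'I_k] =
  alternating_sum f s.
Proof.
elim: k s f => [|k IHk] [|x s] // f => [_|[sk]].
  rewrite (eq_bigr (fun=> f [::])) => [|p _].
    by rewrite sumr_const card_Sn.
  by rewrite permS0 odd_perm1 mul1r enum_ord0.
rewrite sum_perm_lift /= sk; apply: eq_bigr => i _.
rewrite -IHk // big_distrr; apply: eq_bigr => p _ /=.
rewrite odd_lift_perm addbF signr_addb signr_odd -mulrA; congr (_ * (_ * f _)).
set r := [seq nth 0%N s (p j) | j <- enum 'I_k].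
have rk : size r = k by rewrite size_map size_enum_ord.
have ik : (i <= k)%N by rewrite -ltnS.
have str : size (take i r) = i by rewrite size_takel ?rk.
apply: (@eq_from_nth _ 0%N) => [|m].
  by rewrite size_map size_enum_ord size_cat str /= size_drop rk addnS subnKC.
rewrite size_map size_enum_ord => mk.
rewrite (nth_map i) ?size_enum_ord // (_ : nth i _ m = Ordinal mk); last first.
  by apply: val_inj; rewrite /= nth_enum_ord.
case: (unliftP i (Ordinal mk)) => [j|] mE; rewrite mE.
  rewrite lift_perm_lift /=; have -> : m = bump i j by have := congr1 val mE.
  transitivity (nth 0%N r j).
    rewrite (nth_map j) ?size_enum_ord //; congr (nth _ _ (p _)).
    by apply: val_inj; rewrite /= nth_enum_ord.
  rewrite nth_cat str /bump; case: (leqP i j) => ij.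
    by rewrite add1n ltnNge leqW // subSn //= nth_drop subnKC.
  by rewrite add0n ij nth_take.
rewrite lift_perm_id /=; have -> : m = i by have := congr1 val mE.
by rewrite nth_cat str ltnn subnn.
Qed.

(** If the head is inserted at i < p, it lies in the first part, and moving it to the front there
    cancels the sign (-1)^i. Otherwise it moves past i - p entries of the second part and (-1)^p
    remains. So p positions contribute one value and q positions another, which matches the
    recursion of [shuffle_sum] because p! = p (p-1)! and q! = q (q-1)!. *)
Lemma alternating_sum_shuffle g p q s :
  (forall b, alternating (fun a => g a b)) -> (forall a, alternating (g a)) ->
  size s = (p + q)%N ->
  alternating_sum (fun r => g (take p r) (drop p r)) s =
  (p`! * q`!)%:R * shuffle_sum g p s.
Proof.
elim: s p q g => [|x s IHs] p q g gl gr.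
  case: p q => [|p] [|q] // _; rewrite /shuffle_sum /= big_cons big_nil.
  by rewrite !mul1r addr0.
rewrite shuffle_sum_cons /= => sE.
rewrite (eq_bigr (fun i : 'I_(size s).+1 => if (i < p)%N
  then alternating_sum (fun r => g (x :: take p.-1 r) (drop p.-1 r)) s
  else (-1) ^+ p * alternating_sum (fun r => g (take p r) (x :: drop p r)) s)); last first.
  move=> i _.
  have split_r r : size r = size s ->
    exists w z, [/\ r = w ++ z, take i r = w, drop i r = z & size w = i].
    move=> rs; exists (take i r), (drop i r).
    by rewrite cat_take_drop size_takel // rs -ltnS.
  have dropl (w z : seq nat) : (p <= size w)%N -> drop p (w ++ z) = drop p w ++ z.
    rewrite drop_cat leq_eqVlt => /orP[/eqP pw | -> //].
    by rewrite pw ltnn subnn drop0 drop_size.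
  case: ltnP => ip; rewrite -!alternating_sumZ; apply: eq_alternating_sum => r.
    move=> /split_r[w [z [-> -> -> wi]]]; case: p ip {sE dropl} => // p ip.
    rewrite !take_cat !drop_cat wi !ltnNge leqW //= -ltnS ip /= subSn //=.
    by rewrite (alternating_move _ _ _ (gl _)) wi mulrA -expr2 sqrr_sign mul1r.
  move=> /split_r[w [z [-> -> -> wi]]].
  rewrite !takel_cat ?dropl ?wi // (alternating_move _ _ _ (gr _)) mulrA.
  rewrite size_drop wi -{1}(subnKC ip) exprD.
  by rewrite -(mulrA ((-1) ^+ p)) -expr2 sqrr_sign mulr1.
set a := alternating_sum _ s; set b := _ * alternating_sum _ s.
have -> : \sum_(i < (size s).+1) (if (i < p)%N then a else b) =
          p%:R * a + q%:R * b.
  rewrite sE big_split_ord /=.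
  rewrite (eq_bigr (fun=> a)) => [|i _]; last by rewrite ltn_ord.
  rewrite [X in _ + X](eq_bigr (fun=> b)) => [|i _]; last first.
    by rewrite ltnNge leq_addr.
  by rewrite !sumr_const !card_ord !mulr_natl.
rewrite {}/a {}/b mulrDr; congr (_ + _).
  case: p sE => [|p] sE; first by rewrite mul0r mulr0.
  rewrite (IHs p q (fun a b => g (x :: a) b)) ?factS ?natrM ?mulrA //.
  - by move=> b u y z v; rewrite -!cat_cons gl.
  - by case: sE.
case: q sE => [|q] sE.
  rewrite mul0r; have -> : shuffle_sum (fun a b => g a (x :: b)) p s = 0.
    by rewrite /shuffle_sum splits_small ?big_nil // -ltnS sE addn0.
  by rewrite !mulr0.
rewrite (IHs p q (fun a b => g a (x :: b))) ?factS ?natrM //.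
- by ring.
- by move=> a; apply: alternating_cons.
- by move: sE; rewrite addnS => - [].
Qed.
End Shuffle.

(** * Contractions *)

Fixpoint subsets (r : nat) (L : seq nat) : seq (seq nat) :=
  if r is r'.+1 then
    if L is x :: L' then [seq x :: c | c <- subsets r' L'] ++ subsets r L'
    else [::]
  else [:: [::]].

Lemma mem_subsets r L c : (c \in subsets r L) = subseq c L && (size c == r).
Proof.
elim: L r c => [|x L IHL] [|r] [|y c] //=; rewrite ?inE ?eqxx ?andbF //.
  by rewrite mem_cat IHL sub0seq andTb orbC; apply/mapP => -[].
rewrite mem_cat IHL /= eqSS; case: (y =P x) => [-> | yx].
  rewrite mem_map ?IHL => [|u v []//].
  case: (size c == r); rewrite ?andbF // !andbT.
  apply/orb_idr; apply: subseq_trans; exact: subseq_cons.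
by rewrite orb_idl // => /mapP[z _ []].
Qed.

Lemma subsets_uniq r L : uniq L -> uniq (subsets r L).
Proof.
elim: L r => [|x L IHL] [|r] //= /andP[xL uL].
rewrite cat_uniq map_inj_uniq ?IHL // => [|u v []//].
rewrite andbT; apply/hasPn => c; rewrite mem_subsets => /andP[cL _].
apply/mapP => -[d _ cE]; case/negP: xL; apply: (mem_subseq cL).
by rewrite cE inE eqxx.
Qed.

Lemma sorted_subset r n s : sorted ltn s -> all (gtn n) s -> size s = r ->
  s \in subsets r (iota 0 n).
Proof.
move=> ss /allP sn <-; rewrite mem_subsets eqxx andbT.
suff -> : s = [seq i <- iota 0 n | i \in s] by apply: filter_subseq.
apply: (irr_sorted_eq ltn_trans ltnn) => // [|i].
  by apply: sorted_filter; [apply: ltn_trans | apply: iota_ltn_sorted].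
by rewrite mem_filter mem_iota; case: (boolP (i \in s)) => // /sn.
Qed.

Lemma subset_sorted r n s : s \in subsets r (iota 0 n) ->
  [/\ sorted ltn s, all (gtn n) s & size s = r].
Proof.
rewrite mem_subsets => /andP[sn /eqP sr]; split=> //.
  exact: subseq_sorted (ltn_trans) _ _ sn (iota_ltn_sorted _ _).
by apply/allP => i /(mem_subseq sn); rewrite mem_iota.
Qed.

Section Contraction.
Variable K : numFieldType.
Implicit Types (f phi F : seq nat -> K) (s t u v : seq nat).

Fixpoint tuple_sum r L f : K :=
  if r is r'.+1 then \sum_(i <- L) tuple_sum r' L (fun c => f (i :: c))
  else f [::].

Lemma tuple_sumS r L f :
  tuple_sum r.+1 L f = \sum_(i <- L) tuple_sum r L (fun c => f (i :: c)).
Proof. by []. Qed.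

Lemma eq_tuple_sum r L f f' : f =1 f' -> tuple_sum r L f = tuple_sum r L f'.
Proof.
elim: r f f' => [|r IHr] f f' ff' //=.
by apply: eq_bigr => i _; apply: IHr => c.
Qed.

Lemma tuple_sum0 r L f : f =1 (fun=> 0) -> tuple_sum r L f = 0.
Proof.
elim: r f => [|r IHr] f f0 /=; first exact: f0.
by rewrite big1 // => i _; apply: IHr => c.
Qed.

(** A tuple in which [x] occurs twice contributes nothing, and by symmetry the r + 1 possible
    positions of a single [x] contribute equally. *)
Lemma tuple_sum_cons r x L f :
  (forall u x y v, f (u ++ x :: y :: v) = f (u ++ y :: x :: v)) ->
  (forall u x v, f (u ++ x :: x :: v) = 0) ->
  tuple_sum r.+1 (x :: L) f =
  tuple_sum r.+1 L f + r.+1%:R * tuple_sum r L (fun c => f (x :: c)).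
Proof.
elim: r f => [|r IHr] f fS f0; first by rewrite /= big_cons mul1r addrC.
have fS' y u i j v : f (y :: u ++ i :: j :: v) = f (y :: u ++ j :: i :: v).
  by rewrite -!cat_cons fS.
have f0' y u i v : f (y :: u ++ i :: i :: v) = 0 by rewrite -cat_cons f0.
rewrite [LHS]tuple_sumS big_cons (IHr (fun c => f (x :: c))) //.
rewrite (@tuple_sum0 r) => [|c]; last exact: (f0 [::]).
rewrite mulr0 addr0 (eq_bigr (fun i => tuple_sum r.+1 L (fun c => f (i :: c)) +
  r.+1%:R * tuple_sum r L (fun c => f (x :: i :: c)))) => [|i _]; last first.
  rewrite (IHr (fun c => f (i :: c))) //.
  congr (_ + _ * _); apply: eq_tuple_sum => c; exact: (fS [::]).
rewrite big_split -big_distrr -tuple_sumS.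
rewrite -(tuple_sumS r L (fun c => f (x :: c))) [r.+2%:R]mulrS /=; ring.
Qed.

Lemma tuple_sum_subsets r L f :
  (forall u x y v, f (u ++ x :: y :: v) = f (u ++ y :: x :: v)) ->
  (forall u x v, f (u ++ x :: x :: v) = 0) ->
  tuple_sum r L f = r`!%:R * \sum_(c <- subsets r L) f c.
Proof.
elim: L r f => [|x L IHL] [|r] f fS f0.
- by rewrite /= big_seq1 mul1r.
- by rewrite /= !big_nil mulr0.
- by rewrite /= big_seq1 mul1r.
rewrite tuple_sum_cons // !IHL //=; first last.
- by move=> u y v; rewrite -cat_cons f0.
- by move=> u y z v; rewrite -!cat_cons fS.
by rewrite big_cat big_map factS natrM /=; ring.
Qed.
End Contraction.

(** * Components of forms *)

Lemma tuple_of_seq n k s : all (gtn n.+1) s -> size s = k ->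
  exists t : k.-tuple 'I_n.+1, map val t = s.
Proof.
move=> /allP sn sk; have st : size (map (@inord n) s) == k by rewrite size_map sk.
exists (Tuple st); rewrite /= -map_comp map_id_in // => i si.
by rewrite /= inordK //; apply: sn.
Qed.

Section Entries.
Variable K : numFieldType.
Implicit Types (f phi F : seq nat -> K) (s t u v : seq nat).

(* The junk value 0 for sequences of the wrong length makes [entry F] alternating
   without any side condition; indices beyond n are read as 0 by [inord]. *)
Definition entry n k (F : kform K n.+1 k) s : K :=
  if size s == k then F [tuple inord (nth 0%N s i) | i < k] else 0.

Lemma entry_tuple n k (F : kform K n.+1 k) (t : k.-tuple 'I_n.+1) :
  entry F (map val t) = F t.
Proof.
rewrite /entry size_map size_tuple eqxx; congr (F _); apply: eq_from_tnth => i.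
by rewrite tnth_mktuple (nth_map ord0) ?size_tuple // inord_val (tnth_nth ord0).
Qed.

Lemma entry_size n k (F : kform K n.+1 k) s : size s != k -> entry F s = 0.
Proof. by rewrite /entry => /negPf->. Qed.

Lemma entry_alternating n k (F : kform K n.+1 k) : alternating (entry F).
Proof.
move=> u x y v; rewrite /entry !size_cat /=.
case: eqP => [sk | _]; last by rewrite oppr0.
have u1 : ((size u).+1 < k)%N by rewrite -sk; lia.
have u0 : (size u < k)%N by exact: ltnW.
pose i := Ordinal u0; pose j := Ordinal u1; have ij : i != j.
  by rewrite -val_eqE /= neq_ltn leqnn.
set t := (X in _ = - F X).
have /= := asymvP _ (subvsP F) (tperm i j) t.
rewrite odd_tperm ij expr1 mulN1r => <-; congr (F _).
apply: eq_from_tnth => l; rewrite !tnth_mktuple; congr inord.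
case: tpermP => [-> | -> | /eqP li /eqP lj] /=.
- by rewrite !nth_cat ltnn ltnNge leqnSn subnn subSnn.
- by rewrite !nth_cat ltnn ltnNge leqnSn subnn subSnn.
rewrite !nth_cat; case: ltnP => // ul.
move: li lj; rewrite -!val_eqE /= => li lj.
have -> : (l - size u = (l - size u - 2).+2)%N by lia.
by [].
Qed.

Lemma entryP n k (F G : kform K n.+1 k) :
  {in subsets k (iota 0 n.+1), entry F =1 entry G} -> F = G.
Proof.
move=> FG; apply: formP => t; rewrite -!entry_tuple.
have := signed_sortE (map val t) (entry_alternating F).
have := signed_sortE (map val t) (entry_alternating G).
case E: (signed_sort _) => [[b s]|] -> -> //; congr (_ * _); apply: FG.
have ps := signed_sort_perm E; apply: sorted_subset.
- exact: signed_sort_sorted E.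
- by rewrite (perm_all _ ps); apply/allP => _ /mapP[i _ ->]; exact: (ltn_ord i).
- by rewrite (perm_size ps) size_map size_tuple.
Qed.

Lemma entryD n k (F G : kform K n.+1 k) s : entry (F + G) s = entry F s + entry G s.
Proof. by rewrite /entry; case: eqP => _; rewrite ?addr0 // componentD. Qed.

Lemma entryZ n k a (F : kform K n.+1 k) s : entry (a *: F) s = a * entry F s.
Proof. by rewrite /entry; case: eqP => _; rewrite ?mulr0 // componentZ. Qed.

Lemma entry_antisym n k (h : k.-tuple 'I_n.+1 -> K) f s :
  (forall t : k.-tuple _, h t = f (map val t)) -> size s = k -> all (gtn n.+1) s ->
  entry (antisym h) s = k`!%:R^-1 * alternating_sum f s.
Proof.
move=> hf sk /allP sn; rewrite /entry sk eqxx antisymE; congr (_ * _).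
rewrite -(alternating_sum_perm _ sk); apply: eq_bigr => p _; congr (_ * _).
rewrite hf; congr f; rewrite -[in RHS]val_ord_tuple -map_comp.
apply: eq_map => i /=; rewrite tnth_mktuple inordK //.
by apply: sn; rewrite mem_nth ?sk.
Qed.

(** The product of two alternating functions is symmetric in the contracted indices and vanishes on
    repetitions, so ordering them costs r!. The factor p! q! comes from passing to shuffles, and 1 /
    (p+q)! is the weight of the antisymmetrization. *)
Lemma entry_contraction n r p q (h : (p + q).-tuple 'I_n.+1 -> K) phi F s :
  alternating phi -> alternating F ->
  (forall t : (p + q).-tuple _, h t = tuple_sum r (iota 0 n.+1) (fun c =>
     phi (c ++ take p (map val t)) * F (c ++ drop p (map val t)))) ->
  s \in subsets (p + q) (iota 0 n.+1) ->
  entry (antisym h) s = (p`! * q`! * r`!)%:R / (p + q)`!%:R *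
    shuffle_sum (fun a b => \sum_(c <- subsets r (iota 0 n.+1))
      phi (c ++ a) * F (c ++ b)) p s.
Proof.
move=> phiA FA hE /subset_sorted[_ sn sk].
pose g a b := \sum_(c <- subsets r (iota 0 n.+1)) phi (c ++ a) * F (c ++ b).
rewrite (@entry_antisym _ _ _ (fun r' => r`!%:R * g (take p r') (drop p r'))) //.
  rewrite alternating_sumZ (@alternating_sum_shuffle _ _ _ q) //; first last.
  - move=> a u x y v; rewrite /g -sumrN; apply: eq_bigr => c _.
    by rewrite (alternating_cat c FA) mulrN.
  - move=> b u x y v; rewrite /g -sumrN; apply: eq_bigr => c _.
    by rewrite (alternating_cat c phiA) mulNr.
  by rewrite mulrA mulrA [in RHS]natrM; congr (_ * _); ring.
move=> t; rewrite hE tuple_sum_subsets // => [u x y v | u x v].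
  rewrite -!catA !cat_cons [in LHS]phiA [X in _ * X]FA; ring.
rewrite (@alternating_repeat _ phi) ?mul0r //.
by rewrite -catA cat_uniq /= inE eqxx !andbF.
Qed.

Definition tabulates n (T : seq (bool * seq nat)) phi :=
  forall s, sorted ltn s -> all (gtn n) s ->
    phi s = \sum_(x <- T) (-1) ^+ x.1 * (x.2 == s)%:R.

(* For an index S of the table containing a, the only increasing c such that
   [c ++ a] is a rearrangement of S is the complement of a in S. *)
Definition table_terms (T : seq (bool * seq nat)) (a b : seq nat) :
    seq (bool * seq nat) :=
  flatten [seq
    (if all (mem x.2) a then
       let c := [seq i <- x.2 | i \notin a] in
       if (signed_sort (c ++ a), signed_sort (c ++ b)) is (Some z, Some w)
       then [:: (x.1 (+) z.1 (+) w.1, w.2)] else [::]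
     else [::]) | x <- T].

(** Expanding [phi] by its table and exchanging the sums leaves, for each table index, a sum over
    [c] with at most one nonzero term. *)
Lemma table_termsE n r T phi F a b :
  alternating phi -> alternating F -> tabulates n T phi ->
  {in T, forall x, [/\ sorted ltn x.2, all (gtn n) x.2 & size x.2 = (r + size a)%N]} ->
  uniq a -> all (gtn n) a ->
  \sum_(c <- subsets r (iota 0 n)) phi (c ++ a) * F (c ++ b) =
  \sum_(x <- table_terms T a b) (-1) ^+ x.1 * F x.2.
Proof.
move=> phiA FA phiT TP ua na; rewrite big_flatten big_map.
pose h (x : bool * seq nat) c :=
  if signed_sort (c ++ a) is Some z then
    (-1) ^+ z.1 * ((-1) ^+ x.1 * (x.2 == z.2)%:R) * F (c ++ b) else 0.
transitivity (\sum_(c <- subsets r (iota 0 n)) \sum_(x <- T) h x c).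
  apply: eq_big_seq => c /subset_sorted[sc nc _].
  rewrite (signed_sortE (c ++ a) phiA) /h.
  case E: (signed_sort (c ++ a)) => [z|]; last by rewrite big1_eq mul0r.
  have pz := signed_sort_perm E.
  rewrite phiT ?(signed_sort_sorted E) ?(perm_all _ pz) ?all_cat ?nc //.
  by rewrite big_distrr /= big_distrl.
rewrite exchange_big; apply: eq_big_seq => x xT /=; have [sx nx rx] := TP x xT.
have h0 c : h x c != 0 -> c \in subsets r (iota 0 n) ->
    all (mem x.2) a /\ c = [seq i <- x.2 | i \notin a].
  rewrite /h; case E: (signed_sort _) => [z|]; last by rewrite eqxx.
  case: (x.2 =P z.2) => [xz _ | _]; last by rewrite !mulr0 mul0r eqxx.
  have px : perm_eq x.2 (c ++ a) by rewrite xz (signed_sort_perm E).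
  move=> /subset_sorted[sc _ _]; split.
    by apply/allP => i ia; rewrite /= (perm_mem px) mem_cat ia orbT.
  apply: (irr_sorted_eq ltn_trans ltnn) => // [|i].
    exact: sorted_filter ltn_trans _ _ _.
  rewrite mem_filter (perm_mem px) mem_cat.
  have: uniq (c ++ a) by rewrite -(perm_uniq px) (sorted_uniq ltn_trans ltnn).
  rewrite cat_uniq => /and3P[_ /hasPn ca _].
  by case: (boolP (i \in a)) => [/ca/negPf | _]; rewrite ?orbF.
case: ifP => [ax | nax]; last first.
  rewrite big_nil big_seq big1 // => c cn; apply/eqP; apply: contraFT nax => hc.
  by case: (h0 c hc cn).
set c0 := [seq i <- x.2 | i \notin a].
have ux : uniq x.2 by rewrite (sorted_uniq ltn_trans ltnn).
have pc0 : perm_eq (c0 ++ a) x.2.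
  apply: uniq_perm => // [|i].
    rewrite cat_uniq filter_uniq // ua andbT; apply/hasPn => i ia.
    by rewrite /= mem_filter ia.
  rewrite mem_cat mem_filter; case: (boolP (i \in a)) => [ia|]; rewrite ?orbF //.
  by rewrite orbT; apply/esym/(allP ax).
have c0n : c0 \in subsets r (iota 0 n).
  apply: sorted_subset; first exact: sorted_filter ltn_trans _ _ _.
    by apply/allP => i; rewrite mem_filter => /andP[_ /(allP nx)].
  by apply: (@addIn (size a)); rewrite -size_cat (perm_size pc0).
rewrite (bigD1_seq c0) ?subsets_uniq ?iota_uniq //= big_seq_cond big1 ?addr0.
  have [d dE] := signed_sort_perm_sorted sx pc0.
  rewrite /h dE /= (signed_sortE (c0 ++ b) FA) eqxx mulr1.
  case: (signed_sort _) => [w|]; rewrite ?big_seq1 ?big_nil ?mulr0 //=.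
  by rewrite !signr_addb !mulrA [_ * (-1) ^+ x.1]mulrC.
move=> c /andP[cn /eqP cc0]; apply/eqP; apply: contraT => hc.
by case: (h0 c hc cn) => _ /cc0.
Qed.

End Entries.

(** * Wedge products *)

Lemma mem_splits p s z : z \in splits p s ->
  [/\ subseq z.2.1 s, subseq z.2.2 s, size z.2.1 = p & (size z.2.2 + p)%N = size s].
Proof.
elim: s p z => [|x s IHs] p z /=; first by case: p => //; rewrite inE => /eqP->.
rewrite mem_cat => /orP[|/mapP[y /IHs[ya yb yp ys] ->]] /=; last first.
  rewrite eqxx addSn ys yp; split=> //.
  exact: subseq_trans ya (subseq_cons _ _).
case: p => // p /mapP[y /IHs[ya yb yp ys] ->] /=.
rewrite eqxx addnS ys yp; split=> //.
exact: subseq_trans yb (subseq_cons _ _).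
Qed.

Section Wedge.
Variable K : numFieldType.

(** When the first factor sees only indices below [m] and the second only indices from [m] on, the
    one shuffle that survives is the cut between [u] and [v], with sign +1. *)
Lemma shuffle_sum_separated (g : seq nat -> seq nat -> K) n m p u v :
  (forall a b i, all (gtn n) a -> i \in a -> (m <= i)%N -> g a b = 0) ->
  (forall a b i, all (gtn n) b -> i \in b -> (i < m)%N -> g a b = 0) ->
  all (gtn m) u -> all (gtn n) u -> all (gtn n) v -> all (leq m) v ->
  shuffle_sum g p (u ++ v) = if size u == p then g u v else 0.
Proof.
move=> ga gb um un vn vm.
elim: u p g ga gb um un => [|x u IHu] p g ga gb.
  move=> _ _; elim: v p g {ga} gb {vm}(vm) vn (ga) => [|x v IHv] p g gb /=.
    move=> _ _ _; rewrite /shuffle_sum /=; case: p => [|p].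
      by rewrite big_seq1 mul1r.
    by rewrite big_nil.
  move=> /andP[mx vm] /andP[xn vn] ga; rewrite shuffle_sum_cons.
  rewrite (_ : (if p is _.+1 then _ else _) = 0) ?add0r; last first.
    case: p => // p; rewrite /shuffle_sum big_seq big1 // => z /mem_splits[za _ _ _].
    rewrite (ga _ _ x) ?mulr0 ?mem_head //= xn.
    by apply/allP => i /(mem_subseq za) /(allP vn).
  rewrite IHv // => [|a b i bn ib im|a b i an ia im].
  - by case: p => [|p]; rewrite ?mul1r ?mulr0.
  - by apply: (gb _ _ i); rewrite ?inE ?ib ?orbT //= xn.
  - exact: (ga _ _ i).
move=> /= /andP[xm um] /andP[xn un]; rewrite shuffle_sum_cons.
rewrite [X in _ + _ * X](_ : _ = 0) ?mulr0 ?addr0; last first.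
  rewrite /shuffle_sum big_seq big1 // => z /mem_splits[_ zb _ _].
  rewrite (gb _ _ x) ?mulr0 ?mem_head //= xn.
  apply/allP => i /(mem_subseq zb); rewrite mem_cat.
  by move=> /orP[/(allP un) | /(allP vn)].
case: p => // p; rewrite IHu // => a b i an ia im.
  by apply: (ga _ _ i); rewrite ?inE ?ia ?orbT //= xn.
exact: (gb _ _ i).
Qed.

(** The binomial coefficient in the wedge convention cancels p! q! / (p+q)! exactly, so each shuffle
    has coefficient +1 or -1. *)
Lemma entry_wedge n p q (a : kform K n.+1 p) (b : kform K n.+1 q) s :
  s \in subsets (p + q) (iota 0 n.+1) ->
  entry (wedge a b) s = shuffle_sum (fun x y => entry a x * entry b y) p s.
Proof.
move=> /subset_sorted[_ sn sk]; rewrite /wedge entryZ.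
rewrite (@entry_antisym _ _ _ _ (fun r => entry a (take p r) * entry b (drop p r))) //.
  rewrite (@alternating_sum_shuffle _ (fun x y => entry a x * entry b y) p q) //.
  - have -> : ((p + q)`!)%:R = 'C(p + q, p)%:R * (p`! * q`!)%:R :> K.
      by rewrite -natrM -{3}(addKn p q) bin_fact ?leq_addr.
    by field; rewrite !pnatr_eq0 -!lt0n !fact_gt0 bin_gt0 leq_addr.
  - by move=> y u i j v; rewrite entry_alternating mulNr.
  - by move=> x u i j v; rewrite entry_alternating mulrN.
move=> t; rewrite -(entry_tuple a) -(entry_tuple b).
congr (entry a _ * entry b _); apply: (@eq_from_nth _ 0%N).
- by rewrite size_takel size_map size_tuple // leq_addr.
- rewrite size_map size_tuple => i ip; rewrite nth_take //.
  rewrite !(nth_map ord0) ?size_tuple ?ltn_addr //.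
  have := tnth_mktuple (fun l => tnth t (lshift q l)) (Ordinal ip).
  by rewrite !(tnth_nth ord0) /= => ->.
- by rewrite size_drop size_map size_tuple (size_map _ t) size_tuple addKn.
- rewrite size_map size_tuple => i iq; rewrite nth_drop.
  rewrite !(nth_map ord0) ?size_tuple ?ltn_add2l //.
  have := tnth_mktuple (fun l => tnth t (rshift p l)) (Ordinal iq).
  by rewrite !(tnth_nth ord0) /= => ->.
Qed.

Lemma entry_push m n k (h : 'I_m.+1 -> 'I_n.+1) (F : kform K m.+1 k) u :
  injective h -> all (gtn m.+1) u ->
  entry (push h F) [seq val (h (inord i)) | i <- u] = entry F u.
Proof.
move=> h_inj um; have [uk | uk] := eqVneq (size u) k; last first.
  by rewrite !entry_size ?size_map.
have [t tu] := tuple_of_seq um uk.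
rewrite -tu entry_tuple -(pushE F t h_inj) -entry_tuple; congr entry.
rewrite -!map_comp; apply: eq_map => i /=; by rewrite inord_val.
Qed.

Lemma entry_push0 m n k (h : 'I_m.+1 -> 'I_n.+1) (F : kform K m.+1 k) s i :
  all (gtn n.+1) s -> i \in s -> (forall j, val (h j) != i) ->
  entry (push h F) s = 0.
Proof.
move=> /allP sn si hi; rewrite /entry; case: eqP => // sk.
rewrite antisymE big1 ?mulr0 // => p _; rewrite big1 ?mulr0 // => u /eqP hu.
have ik : (index i s < k)%N by rewrite -sk index_mem.
have := congr1 (fun t => tnth t (p^-1%g (Ordinal ik))) hu.
rewrite tnth_map !tnth_mktuple permKV /= nth_index // => /(congr1 val).
rewrite /= inordK; last exact: (sn i si).
by move=> /eqP; rewrite (negPf (hi _)).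
Qed.

(** The zero-based indices 8 and 9 stand for e_9 and e_10. An increasing index of K^10 is a [u]
    below 8 followed by a shifted [v], and only the shuffle cutting it there meets both factors. *)
Lemma entry_otimes p q (F : kform K 8 p) (V : kform K 2 q) u v :
  (size u + size v = p + q)%N ->
  sorted ltn u -> all (gtn 8) u -> sorted ltn v -> all (gtn 2) v ->
  entry (F \ox V) (u ++ map (addn 8) v) =
  if size u == p then entry F u * entry V v else 0.
Proof.
move=> suv su un sv vn.
have v8 : all (leq 8) (map (addn 8) v) by apply/allP => _ /mapP[i _ ->]; apply: leq_addr.
have v10 : all (gtn 10) (map (addn 8) v).
  by apply/allP => _ /mapP[i /(allP vn) iv ->]; rewrite /= in iv *; lia.
have u10 : all (gtn 10) u by apply: sub_all un => i /= i8; apply: leq_trans i8 _.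
rewrite entry_wedge; last first.
  apply: sorted_subset; rewrite ?all_cat ?u10 ?v10 ?size_cat ?size_map //.
  rewrite !(sorted_pairwise ltn_trans) pairwise_cat in su sv *.
  rewrite su /= pairwise_map (sub_pairwise _ sv) ?andbT => [|i j]; last first.
    by rewrite /= ltn_add2l.
  apply/allrelP => i j /(allP un) iu /(allP v8) jv; exact: leq_trans iu jv.
rewrite (@shuffle_sum_separated _ 10 8) //.
- case: eqP => // _; rewrite -(@entry_push _ _ _ (@lshift 8 2)) //; last exact: lshift_inj.
  rewrite -(@entry_push _ _ _ (@rshift 8 2)) //; last exact: (@rshift_inj 8 2).
  congr (_ * _); [congr entry | congr entry].
    by rewrite -[LHS]map_id; apply/eq_in_map => i iu; rewrite /= inordK //; apply: (allP un).
  by apply/eq_in_map => i iv; rewrite /= inordK //; apply: (allP vn).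
- move=> a b i an ia i8; rewrite (entry_push0 F an ia) ?mul0r // => j /=.
  by rewrite neq_ltn (leq_trans (ltn_ord j)).
- move=> a b i an ia i8; rewrite (entry_push0 V an ia) ?mulr0 // => j /=.
  by rewrite neq_ltn orbC (leq_trans i8) ?leq_addr.
Qed.
End Wedge.

(** * Component tables *)

(** Listed indices such as (1276) are not increasing; sorting them supplies the signs, and [predn]
    passes to zero-based indices. No listed index repeats an entry, so the default of [odflt] never
    occurs. *)
Definition Theta_table : seq (bool * seq nat) :=
  [seq odflt (false, [::]) (signed_sort (map predn s)) | s <- Theta_indices].

Definition hatTheta_table : seq (bool * seq nat) :=
  [seq (x.1, x.2 ++ [:: 8; 9]%N) | x <- Theta_table].

(** Free of field elements, so that statements about contractions can be settled by evaluation. *)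
Definition contraction_terms T p s : seq (bool * seq nat) :=
  flatten [seq [seq (z.1 (+) y.1, y.2) | y <- table_terms T z.2.1 z.2.2]
          | z <- splits p s].

Definition table_ok n k (T : seq (bool * seq nat)) :=
  all (fun x => [&& sorted ltn x.2, all (gtn n) x.2 & size x.2 == k]) T.

Section Tables.
Variable K : numFieldType.
Implicit Types (phi F : seq nat -> K) (T : seq (bool * seq nat)) (s : seq nat).

Definition eval F (l : seq (bool * seq nat)) : K :=
  \sum_(x <- l) (-1) ^+ x.1 * F x.2.

Lemma entry_contraction_table n r p q (h : (p + q).-tuple 'I_n.+1 -> K) T phi F s :
  alternating phi -> alternating F ->
  (forall t : (p + q).-tuple _, h t = tuple_sum r (iota 0 n.+1) (fun c =>
     phi (c ++ take p (map val t)) * F (c ++ drop p (map val t)))) ->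
  tabulates n.+1 T phi -> table_ok n.+1 (r + p) T ->
  s \in subsets (p + q) (iota 0 n.+1) ->
  entry (antisym h) s = (p`! * q`! * r`!)%:R / (p + q)`!%:R *
    eval F (contraction_terms T p s).
Proof.
move=> phiA FA hE phiT Tok sn; rewrite (entry_contraction phiA FA hE sn).
have [ss s_n _] := subset_sorted sn; congr (_ * _).
rewrite /shuffle_sum /eval big_flatten big_map; apply: eq_big_seq => z zs.
have [za _ zp _] := mem_splits zs.
rewrite (@table_termsE _ _ r _ _ _ _ _ phiA FA phiT) ?big_map ?big_distrr /=.
- by apply: eq_bigr => y _; rewrite signr_addb mulrA.
- by move=> x /(allP Tok) /and3P[? ? /eqP xk]; rewrite zp.
- by rewrite (sorted_uniq ltn_trans ltnn) // (subseq_sorted ltn_trans za).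
- by apply/allP => i /(mem_subseq za) /(allP s_n).
Qed.

Lemma eval_indicator T s b : uniq (unzip2 T) -> (b, s) \in T ->
  \sum_(x <- T) (-1) ^+ x.1 * (x.2 == s)%:R = (-1) ^+ b :> K.
Proof.
elim: T => //= x T IHT /andP[xT uT]; rewrite big_cons inE.
case: ((b, s) =P x) => [xE _ | _ /= bT] /=.
  subst x; rewrite eqxx mulr1 big_seq big1 ?addr0 // => y yT.
  case: (y.2 =P s) => [ys | _]; last by rewrite mulr0.
  by case/negP: xT; rewrite /= -ys; apply/mapP; exists y.
rewrite IHT //; case: (x.2 =P s) => [xs | _]; last by rewrite mulr0 add0r.
by case/negP: xT; rewrite xs; apply/mapP; exists (b, s).
Qed.

(** For [s] in the table, a listed S sorts to [s]; Theta is 1 on S, so its value on [s] is the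
    sorting sign. For other increasing [s] no rearrangement is listed, since sorting it would put
    [s] in the table. *)
Lemma Theta_tabulated : tabulates 8 Theta_table (entry (Theta K)).
Proof.
move=> s ss s8.
have tI : table_ok 8 4 Theta_table by [].
have [s4 | s4] := eqVneq (size s) 4%N; last first.
  rewrite entry_size // big_seq big1 // => x /(allP tI) /and3P[_ _ /eqP x4].
  by case: eqP => [xs | _]; rewrite ?mulr0 // -xs x4 in s4 *.
have [t ts] := tuple_of_seq s8 s4; have TA := entry_alternating (Theta K).
case: (boolP (s \in unzip2 Theta_table)) => sT.
  case/mapP: (sT) => -[b s'] bT /= sE; subst s'; rewrite (eval_indicator _ bT) //.
  case/mapP: bT => S ST; have oST : all (fun S => [&& all (gtn 8) (map predn S),
    size (map predn S) == 4%N, map succn (map predn S) == S &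
    isSome (signed_sort (map predn S))]) Theta_indices by [].
  have /and4P[S8 /eqP S4 /eqP SS S0] := allP oST S ST.
  have := signed_sortE (map predn S) TA; case: signed_sort S0 => // z _ /= fS zE.
  rewrite -{}zE /= in fS; have [t' tS] := tuple_of_seq S8 S4.
  have f1 : entry (Theta K) (map predn S) = 1.
    rewrite -tS entry_tuple Theta_listedE // /Theta_listed.
    by rewrite -[X in X \in _]/(map (succn \o val) t') map_comp tS SS.
  by rewrite -[LHS](signrMK b) -fS f1 mulr1.
rewrite big_seq big1 => [|x xT]; last first.
  case: (x.2 =P s) => [xs | _]; last by rewrite mulr0.
  by case/negP: sT; rewrite -xs; apply/mapP; exists x.
rewrite -ts entry_tuple; apply: Theta_unlistedE => p; apply: contra sT => pT.
have pts : perm_eq (map val (permute p t)) s.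
  by rewrite -ts perm_map //; apply/tuple_permP; exists p.
have [b bE] := signed_sort_perm_sorted ss pts.
apply/mapP; exists (b, s) => //; apply/mapP; exists (map (succn \o val) (permute p t)) => //.
by rewrite map_comp -map_comp map_id_in ?bE // => i.
Qed.

Lemma entry_eps : entry (eps K) [:: 0; 1]%N = 1.
Proof. by rewrite -[RHS](epsE K) -entry_tuple. Qed.

Lemma sorted_split s : sorted ltn s -> all (gtn 10) s ->
  exists u v, [/\ s = u ++ map (addn 8) v, sorted ltn u, all (gtn 8) u,
                sorted ltn v & all (gtn 2) v].
Proof.
move=> ss s10; exists [seq i <- s | (i < 8)%N], [seq (i - 8)%N | i <- s & (8 <= i)%N].
have s8 : [seq i <- s | (8 <= i)%N] = [seq (8 + (i - 8))%N | i <- s & (8 <= i)%N].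
  by rewrite -[LHS]map_id; apply/eq_in_map => i; rewrite mem_filter => /andP[i8 _]; rewrite subnKC.
have fs P : sorted ltn (filter P s) by apply: sorted_filter ss; apply: ltn_trans.
have fC P Q : all P s -> all P (filter Q s).
  by move=> /allP sP; apply/allP => i; rewrite mem_filter => /andP[_ /sP].
split=> //; last 1 first.
- rewrite all_map; apply/allP => i; rewrite mem_filter => /andP[i8 /(allP s10)] /=.
  by move=> i10; rewrite /= ltn_subLR.
- rewrite -map_comp -s8; apply: perm_sorted_ltn => //.
    rewrite (sorted_pairwise ltn_trans) pairwise_cat -!(sorted_pairwise ltn_trans) !fs !andbT.
    apply/allrelP => i j; rewrite !mem_filter => /andP[i8 _] /andP[j8 _].
    exact: leq_trans i8 j8.
  rewrite perm_sym (@eq_filter _ (leq 8) (predC (fun i => i < 8)%N)); last first.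
    by move=> i /=; rewrite -leqNgt.
  exact/permPl/perm_filterC.
- exact: filter_all.
apply: (@homo_sorted_in _ _ (leq 8) _ ltn ltn) (filter_all _ _) (fs _).
by move=> i j i8 j8 /= ij; rewrite ltn_sub2r // (leq_ltn_trans i8).
Qed.

Lemma hatTheta_tabulated : tabulates 10 hatTheta_table (entry (hatTheta K)).
Proof.
move=> s ss s10; have tI : table_ok 10 6 hatTheta_table by [].
have [s6 | s6] := eqVneq (size s) 6%N; last first.
  rewrite entry_size // big_seq big1 // => x /(allP tI) /and3P[_ _ /eqP x6].
  by case: eqP => [xs | _]; rewrite ?mulr0 // -xs x6 in s6 *.
have [u [v [sE su u8 sv v2]]] := sorted_split ss s10.
rewrite sE size_cat size_map in s6 *; rewrite (entry_otimes (Theta K) (eps K)) // big_map /=.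
rewrite (eq_big_seq (fun x : bool * seq nat => (v == [:: 0; 1]%N)%:R * ((-1) ^+ x.1 * (x.2 == u)%:R))).
  rewrite -big_distrr /= -Theta_tabulated //.
  have [u4 | u4] := eqVneq (size u) 4%N; last first.
    by rewrite entry_size ?mulr0.
  have vs : v \in subsets 2 (iota 0 2).
    by apply: sorted_subset => //; move: s6; rewrite u4 => - [].
  by rewrite inE in vs; rewrite vs mul1r (eqP vs) entry_eps mulr1.
move=> x xT; rewrite mulrCA -natrM mulnb; congr (_ * (nat_of_bool _)%:R).
have /and3P[_ x8 _] := allP (isT : table_ok 8 4 Theta_table) x xT.
have f8 w : all (gtn 8) w -> [seq i <- w | (i < 8)%N] = w by move/all_filterP.
apply/eqP/andP => [e | [/eqP-> /eqP->] //].
have := congr1 (filter (fun i => i < 8)%N) e; rewrite !filter_cat (f8 u) // (f8 x.2) // [in LHS]/= cats0.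
rewrite (_ : filter _ (map _ v) = [::]) ?cats0 => [xu|]; last first.
  apply/eqP; rewrite -size_eq0 size_filter count_map; apply/eqP.
  by rewrite (@eq_count _ _ pred0) ?count_pred0 // => i /=; rewrite ltnNge leq_addr.
move: e; rewrite xu => /eqP; rewrite eqseq_cat // eqxx /= => /eqP e.
by split=> //; rewrite -(inj_eq (inj_map (@addnI 8))) -e.
Qed.

End Tables.

(** * The five operators in components *)

Section Operators.
Variable K : numFieldType.

Lemma sum_iota n (G : nat -> K) : \sum_(i <- iota 0 n) G i = \sum_(i < n) G i.
Proof. by rewrite -(big_mkord xpredT) /index_iota subn0. Qed.

(** The constants in this and the next four lemmas are p! q! r! / (p+q)!, with r contracted indices
    and p, q free indices on Theta (or its lift) and on F. *)
Lemma entry_b3 (F : kform K 8 3) s : s \in subsets 3 (iota 0 8) ->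
  entry (b3 F) s = 2 / 3 * eval (entry F) (contraction_terms Theta_table 2 s).
Proof.
move=> sn; rewrite /b3 lfunE /=.
rewrite (@entry_contraction_table K 7 2 2 1 _ Theta_table (entry (Theta K)) (entry F)) //.
- congr (_ * _); by rewrite /= !factS fact0; field.
- exact: entry_alternating.
- exact: entry_alternating.
- case=> -[|a[|b[|c[|//]]]] // k3; rewrite tuple_sumS sum_iota; apply: eq_bigr => i _.
  rewrite tuple_sumS sum_iota; apply: eq_bigr => j _; by rewrite -!entry_tuple.
- exact: Theta_tabulated.
Qed.

Lemma entry_b4 (F : kform K 8 4) s : s \in subsets 4 (iota 0 8) ->
  entry (b4 F) s = 1 / 3 * eval (entry F) (contraction_terms Theta_table 2 s).
Proof.
move=> sn; rewrite /b4 lfunE /=.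
rewrite (@entry_contraction_table K 7 2 2 2 _ Theta_table (entry (Theta K)) (entry F)) //.
- congr (_ * _); by rewrite /= !factS fact0; field.
- exact: entry_alternating.
- exact: entry_alternating.
- case=> -[|a[|b[|c[|d[|//]]]]] // k3; rewrite tuple_sumS sum_iota; apply: eq_bigr => i _.
  rewrite tuple_sumS sum_iota; apply: eq_bigr => j _; rewrite -!entry_tuple; congr (_ * _).
  (* [b4] contracts the last two indices of F; moving one pair past the other takes four exchanges
     and preserves the sign. *)
  have FA := entry_alternating F; have F4 x y z w :
      entry F [:: x; y; z; w] = entry F [:: z; w; x; y].
    rewrite (FA [:: x] y z [:: w]) (FA [::] x z [:: y; w]).
    by rewrite (FA [:: z; x] y w [::]) (FA [:: z] x w [:: y]) /= !opprK.
  by rewrite [LHS]F4.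
- exact: Theta_tabulated.
Qed.

Lemma entry_d (F : kform K 8 5) s : s \in subsets 3 (iota 0 8) ->
  entry (d_Theta F) s = 2 * eval (entry F) (contraction_terms Theta_table 1 s).
Proof.
move=> sn; rewrite /d_Theta lfunE /=.
rewrite (@entry_contraction_table K 7 3 1 2 _ Theta_table (entry (Theta K)) (entry F)) //.
- congr (_ * _); by rewrite /= !factS fact0; field.
- exact: entry_alternating.
- exact: entry_alternating.
- case=> -[|a[|b[|c[|//]]]] // k3; rewrite tuple_sumS sum_iota; apply: eq_bigr => i _.
  rewrite tuple_sumS sum_iota; apply: eq_bigr => j _; rewrite tuple_sumS sum_iota; apply: eq_bigr => k _.
  by rewrite -!entry_tuple.
- exact: Theta_tabulated.
Qed.

Lemma entry_dt (F : kform K 8 3) s : s \in subsets 5 (iota 0 8) ->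
  entry (dt_Theta F) s = 1 / 10 * eval (entry F) (contraction_terms Theta_table 3 s).
Proof.
move=> sn; rewrite /dt_Theta lfunE /=.
rewrite (@entry_contraction_table K 7 1 3 2 _ Theta_table (entry (Theta K)) (entry F)) //.
- congr (_ * _); by rewrite /= !factS fact0; field.
- exact: entry_alternating.
- exact: entry_alternating.
- case=> -[|a[|b[|c[|d[|e[|//]]]]]] // k3; rewrite tuple_sumS sum_iota; apply: eq_bigr => i _.
  by rewrite -!entry_tuple.
- exact: Theta_tabulated.
Qed.

Lemma entry_b_hat (F : kform K 10 5) s : s \in subsets 5 (iota 0 10) ->
  entry (b_hat F) s = 3 / 5 * eval (entry F) (contraction_terms hatTheta_table 3 s).
Proof.
move=> sn; rewrite /b_hat lfunE /=.
rewrite (@entry_contraction_table K 9 3 3 2 _ hatTheta_table (entry (hatTheta K)) (entry F)) //.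
- congr (_ * _); by rewrite /= !factS fact0; field.
- exact: entry_alternating.
- exact: entry_alternating.
- case=> -[|a[|b[|c[|d[|e[|//]]]]]] // k3; rewrite tuple_sumS sum_iota; apply: eq_bigr => i _.
  rewrite tuple_sumS sum_iota; apply: eq_bigr => j _; rewrite tuple_sumS sum_iota; apply: eq_bigr => k _.
  by rewrite -!entry_tuple.
- exact: hatTheta_tabulated.
Qed.
End Operators.

(** * Block form of the ten-dimensional operator *)

Lemma contraction_terms_ok :
  [/\ {in subsets 5 (iota 0 8), forall s, table_ok 8 3 (contraction_terms Theta_table 3 s)},
      {in subsets 4 (iota 0 8), forall s, table_ok 8 4 (contraction_terms Theta_table 2 s)},
      {in subsets 3 (iota 0 8), forall s, table_ok 8 5 (contraction_terms Theta_table 1 s)} &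
      {in subsets 3 (iota 0 8), forall s, table_ok 8 3 (contraction_terms Theta_table 2 s)}].
Proof. by split; apply/allP; vm_compute. Qed.

Lemma eq_in_all (T S : eqType) (f g : T -> S) l :
  all (fun x => f x == g x) l -> {in l, f =1 g}.
Proof. by move=> /allP fg x /fg /eqP. Qed.

(** The lifted form carries both 8 and 9, so whichever of them is not a free index is contracted and
    appears in F instead. The sign flip in the second clause is that of * e_10 = - e_9. The lists
    agree term by term, in the same order. *)
Lemma contraction_terms_hat :
  [/\ {in subsets 5 (iota 0 8), forall s, contraction_terms hatTheta_table 3 s =
        [seq (x.1, x.2 ++ [:: 8; 9]%N) | x <- contraction_terms Theta_table 3 s]},
      {in subsets 4 (iota 0 8), forall s, contraction_terms hatTheta_table 3 (s ++ [:: 8]%N) =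
        [seq (~~ x.1, x.2 ++ [:: 9]%N) | x <- contraction_terms Theta_table 2 s]},
      {in subsets 4 (iota 0 8), forall s, contraction_terms hatTheta_table 3 (s ++ [:: 9]%N) =
        [seq (x.1, x.2 ++ [:: 8]%N) | x <- contraction_terms Theta_table 2 s]} &
      {in subsets 3 (iota 0 8), forall s, contraction_terms hatTheta_table 3 (s ++ [:: 8; 9]%N) =
        contraction_terms Theta_table 1 s}].
Proof. by split; apply: eq_in_all; vm_compute. Qed.

Section Blocks.
Variable K : numFieldType.

Lemma star0E (c : kform K 2 0) : star0 c = entry c [::] *: eps K.
Proof. by rewrite /star0 lfunE /= /star0_fun -entry_tuple. Qed.
Lemma star1E (V : kform K 2 1) :
  star1 V = entry V [:: 0]%N *: e K 1 - entry V [:: 1]%N *: e K 0.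
Proof. by rewrite /star1 lfunE /= /star1_fun -!entry_tuple. Qed.
Lemma star2E (W : kform K 2 2) : star2 W = entry W [:: 0; 1]%N *: Defs.one K 2.
Proof. by rewrite /star2 lfunE /= /star2_fun -!entry_tuple. Qed.

Lemma entry_one : entry (Defs.one K 2) [::] = 1.
Proof. by rewrite -(oneE K (n := 2) [tuple]) -entry_tuple. Qed.

Lemma entry_e (a b : 'I_2) : entry (e K a) [:: val b] = (b == a)%:R.
Proof. by rewrite -eE -entry_tuple. Qed.

Lemma eval_scale (l : seq (bool * seq nat)) (h : bool * seq nat -> bool * seq nat)
    (F G : seq nat -> K) a :
  {in l, forall x, (-1) ^+ (h x).1 * F (h x).2 = a * ((-1) ^+ x.1 * G x.2)} ->
  eval F (map h l) = a * eval G l.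
Proof.
move=> FG; rewrite /eval big_map big_distrr; exact: eq_big_seq.
Qed.

Variant block_index : seq nat -> Prop :=
  | Block5 u of u \in subsets 5 (iota 0 8) : block_index u
  | Block40 u of u \in subsets 4 (iota 0 8) : block_index (u ++ [:: 8]%N)
  | Block41 u of u \in subsets 4 (iota 0 8) : block_index (u ++ [:: 9]%N)
  | Block3 u of u \in subsets 3 (iota 0 8) : block_index (u ++ [:: 8; 9]%N).

Lemma block_indexP s : s \in subsets 5 (iota 0 10) -> block_index s.
Proof.
move=> /subset_sorted[ss s10 s5]; have [u [v [sE su u8 sv v2]]] := sorted_split ss s10.
have us : u \in subsets (size u) (iota 0 8) by apply: sorted_subset.
have: v \in subsets (size v) (iota 0 2) by apply: sorted_subset.
move: us s5; rewrite {}sE size_cat size_map.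
case: v {sv v2} => [|a [|b [|c v]]] us s5.
- by rewrite addn0 in s5; rewrite s5 in us; move=> _; rewrite cats0; constructor.
- rewrite addn1 in s5; case: s5 => s5; rewrite s5 in us.
  by rewrite !inE => /orP[] /eqP[->]; constructor.
- rewrite addn2 in s5; case: s5 => s5; rewrite s5 in us.
  by rewrite !inE => /eqP[-> ->]; constructor.
- by rewrite mem_subsets => /andP[/size_subseq].
Qed.

Definition has_blocks (A : kform K 8 5) (c : kform K 2 0) (B : kform K 8 4)
    (V : kform K 2 1) (C : kform K 8 3) (W : kform K 2 2) (X : kform K 10 5) :=
  [/\ {in subsets 5 (iota 0 8), forall u, entry X u = entry A u * entry c [::]},
      {in subsets 4 (iota 0 8), forall u,
        entry X (u ++ [:: 8]%N) = entry B u * entry V [:: 0]%N},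
      {in subsets 4 (iota 0 8), forall u,
        entry X (u ++ [:: 9]%N) = entry B u * entry V [:: 1]%N} &
      {in subsets 3 (iota 0 8), forall u,
        entry X (u ++ [:: 8; 9]%N) = entry C u * entry W [:: 0; 1]%N}].

Lemma entry_blocks (A : kform K 8 5) (c : kform K 2 0) (B : kform K 8 4)
    (V : kform K 2 1) (C : kform K 8 3) (W : kform K 2 2) :
  has_blocks A c B V C W ((A \ox c : kform K 10 5) + (B \ox V : kform K 10 5)
                          + (C \ox W : kform K 10 5)).
Proof.
split=> u /subset_sorted[su u8 uk].
- rewrite -{1}[u]cats0 -[[::]]/(map (addn 8) [::]) !entryD.
  rewrite (entry_otimes A c) ?uk // (entry_otimes B V) ?uk // (entry_otimes C W) ?uk //=.
  by rewrite !addr0.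
- rewrite -[[:: 8]%N]/(map (addn 8) [:: 0]%N) !entryD.
  rewrite (entry_otimes A c) ?uk // (entry_otimes B V) ?uk // (entry_otimes C W) ?uk //=.
  by rewrite add0r addr0.
- rewrite -[[:: 9]%N]/(map (addn 8) [:: 1]%N) !entryD.
  rewrite (entry_otimes A c) ?uk // (entry_otimes B V) ?uk // (entry_otimes C W) ?uk //=.
  by rewrite add0r addr0.
- rewrite -[[:: 8; 9]%N]/(map (addn 8) [:: 0; 1]%N) !entryD.
  rewrite (entry_otimes A c) ?uk // (entry_otimes B V) ?uk // (entry_otimes C W) ?uk //=.
  by rewrite !add0r.
Qed.

Lemma otimesZ p q a (F : kform K 8 p) (V : kform K 2 q) :
  (a *: F) \ox V = a *: (F \ox V).
Proof. by rewrite -[LHS]/(otimesr_fun V (a *: F)) linearZ. Qed.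

(** The block coefficients are quotients of contraction weights: 6 = (3/5) / (1/10), 9/5 = (3/5) /
    (1/3) and 3/10 = (3/5) / 2. *)
Lemma b_hat_has_blocks F5 c F4 V F3 W X Y :
  has_blocks F5 c F4 V F3 W X ->
  has_blocks (6 *: dt_Theta F3) (star2 W) ((9 / 5) *: b4 F4) (star1 V)
             ((3 / 10) *: d_Theta F5) (star0 c) Y ->
  b_hat X = Y.
Proof.
move=> [X5 X40 X41 X3] [Y5 Y40 Y41 Y3].
have [ok5 ok4 ok3 _] := contraction_terms_ok.
have [h5 h40 h41 h3] := contraction_terms_hat.
apply: entryP => s sn; rewrite entry_b_hat //.
have tk n k T x : table_ok n k T -> x \in T -> x.2 \in subsets k (iota 0 n).
  by move=> /allP Tk /Tk /and3P[? ? /eqP ?]; apply: sorted_subset.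
case: (block_indexP sn) => u un.
- rewrite Y5 // (h5 u un) entryZ entry_dt //.
  rewrite (eval_scale (a := entry W [:: 0; 1]%N) (G := entry F3)) => [|x xT]; last first.
    by rewrite X3 ?(tk _ _ _ _ (ok5 u un)) //=; ring.
  by rewrite star2E entryZ entry_one; field.
- rewrite Y40 // (h40 u un) entryZ entry_b4 //.
  rewrite (eval_scale (a := - entry V [:: 1]%N) (G := entry F4)) => [|x xT]; last first.
    by rewrite /= X41 ?(tk _ _ _ _ (ok4 u un)) //= signrN; ring.
  by rewrite star1E entryD -scaleN1r !entryZ (entry_e 1 0) (entry_e 0 0) /=; field.
- rewrite Y41 // (h41 u un) entryZ entry_b4 //.
  rewrite (eval_scale (a := entry V [:: 0]%N) (G := entry F4)) => [|x xT]; last first.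
    by rewrite /= X40 ?(tk _ _ _ _ (ok4 u un)) //=; ring.
  by rewrite star1E entryD -scaleN1r !entryZ (entry_e 1 1) (entry_e 0 1) /=; field.
- rewrite Y3 // (h3 u un) entryZ entry_d //.
  (* In this block the term lists agree without relabelling; the identity map is inserted to match
     [eval_scale]. *)
  rewrite -[in LHS](map_id (contraction_terms _ _ _)).
  rewrite (eval_scale (a := entry c [::]) (G := entry F5)) => [|x xT]; last first.
    by rewrite X5 ?(tk _ _ _ _ (ok3 u un)) //=; ring.
  by rewrite star0E entryZ entry_eps; field.
Qed.

Lemma b_hat_blocks (F5 : kform K 8 5) (c : kform K 2 0) (F4 : kform K 8 4)
    (V : kform K 2 1) (F3 : kform K 8 3) (W : kform K 2 2) :
  b_hat ((F5 \ox c : kform K 10 5) + (F4 \ox V : kform K 10 5)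
         + (F3 \ox W : kform K 10 5)) =
    6 *: (dt_Theta F3 \ox star2 W : kform K 10 5)
    + (9 / 5) *: (b4 F4 \ox star1 V : kform K 10 5)
    + (3 / 10) *: (d_Theta F5 \ox star0 c : kform K 10 5).
Proof.
rewrite -(otimesZ 6 (dt_Theta F3) (star2 W)) -(otimesZ (9 / 5) (b4 F4) (star1 V)).
rewrite -(otimesZ (3 / 10) (d_Theta F5) (star0 c)).
exact: b_hat_has_blocks (entry_blocks _ _ _ _ _ _) (entry_blocks _ _ _ _ _ _).
Qed.

End Blocks.

(** * Ranks and eigenspaces *)

(** With a full-rank factorization Q = L R, the relation Q Q = c Q cancels to R L = c on a space of
    dimension rank Q, and tr (L R) = tr (R L). *)
Lemma rank_trace (K : fieldType) n (Q : 'M[K]_n) c :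
  Q *m Q = c *: Q -> c * (\rank Q)%:R = \tr Q.
Proof.
move=> QQ; have factored r (L : 'M_(n, r)) (R : 'M_(r, n)) L' R' :
    L *m R = Q -> L' *m L = 1%:M -> R *m R' = 1%:M -> c * r%:R = \tr Q.
  move=> LR L'L RR'; have RL : R *m L = c%:M.
    have -> : R *m L = L' *m (L *m R *m (L *m R)) *m R'.
      by rewrite !mulmxA L'L mul1mx -!mulmxA RR' mulmx1.
    by rewrite LR QQ -LR -scalemxAr -scalemxAl !mulmxA L'L mul1mx RR' scalemx1.
  by rewrite -LR mxtrace_mulC RL mxtrace_scalar mulr_natr.
have [L' L'L] := row_fullP (col_base_full Q).
have [R' RR'] := row_freeP (row_base_free Q).
exact: factored (mulmx_base Q) L'L RR'.
Qed.

Section Eigen.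
Variables (K : fieldType) (V : vectType K).
Implicit Types (f : 'End(V)) (l : seq K).

Lemma leigenspaceP f a v :
  reflect (f v = a *: v) (v \in passmx.leigenspace f a).
Proof.
rewrite /passmx.leigenspace memv_ker add_lfunE opp_lfunE scale_lfunE id_lfunE.
by rewrite subr_eq0; apply: eqP.
Qed.

(** Applying f - b kills the summand of [b] and multiplies each other one by a - b, so the induction
    hypothesis applies to the rest. *)
Lemma leigenspace_independent f l (v : K -> V) : uniq l ->
  {in l, forall a, v a \in passmx.leigenspace f a} ->
  \sum_(a <- l) v a = 0 -> {in l, forall a, v a = 0}.
Proof.
elim: l v => [|b l IHl] v //= /andP[bl ul] vE.
rewrite big_cons => v0.
have vl : {in l, forall a, v a = 0}.
  have wl : {in l, forall a, (a - b) *: v a = 0}.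
    apply: IHl => // [a al|].
      by apply: rpredZ; apply: vE; rewrite inE al orbT.
    have := congr1 f v0; rewrite linearD linear_sum linear0 /=.
    rewrite (leigenspaceP _ _ _ (vE b (mem_head _ _))).
    rewrite (eq_big_seq (fun a => a *: v a)) => [fv0|a al]; last first.
      by apply/leigenspaceP/vE; rewrite inE al orbT.
    rewrite (eq_bigr (fun a => a *: v a - b *: v a)) => [|a _]; last first.
      by rewrite scalerBl.
    rewrite sumrB -scaler_sumr -(addKr (v b) (\sum_(i <- l) v i)) v0 addr0.
    by rewrite scalerN opprK addrC.
  move=> a al; have /eqP := wl a al; rewrite scaler_eq0 subr_eq0.
  by case: eqP al bl => [-> -> //|_ _ _ /eqP].
move=> a; rewrite inE => /orP[/eqP-> | /vl//].
by move: v0; rewrite big_seq big1 // addr0.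
Qed.

Lemma sum_dim_leigenspace f l : uniq l ->
  (\sum_(a <- l) \dim (passmx.leigenspace f a) <= \dim {:V})%N.
Proof.
move=> ul; pose E (i : 'I_(size l)) := passmx.leigenspace f l`_i.
have dE : directv (\sum_i E i).
  apply/directv_sum_independent => u uE u0 i _.
  (* The direct sum is indexed by positions, the independence lemma by values; since [l] has no
     repetition, gathering the positions of a value returns a single vector. *)
  pose v (a : K) := \sum_(j : 'I_(size l) | l`_j == a) u j.
  have vE (j : 'I_(size l)) : v l`_j = u j.
    rewrite /v (bigD1 j) //= big1 ?addr0 // => k /andP[/eqP kj].
    by rewrite -val_eqE /= -(nth_uniq 0 (ltn_ord k) (ltn_ord j) ul) kj eqxx.
  rewrite -vE; apply: (leigenspace_independent (f := f) ul) => [a al||].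
  - have ia : (index a l < size l)%N by rewrite index_mem.
    have := vE (Ordinal ia); rewrite /= nth_index // => ->.
    by have := uE (Ordinal ia) isT; rewrite /E /= nth_index.
  - rewrite (big_nth 0) big_mkord -[RHS]u0; apply: eq_bigr => j _; exact: vE.
  - exact: mem_nth.
rewrite (big_nth 0) big_mkord -(directvP dE) /=.
exact: dimvS (subvf _).
Qed.

End Eigen.

(** * Forms as row vectors *)

Section Forms.
Variable K : numFieldType.

(* The factor k! undoes the weight of the antisymmetrization. *)
Definition form_of n k (G : seq nat -> K) : kform K n.+1 k :=
  k`!%:R *: antisym (fun t : k.-tuple 'I_n.+1 =>
    if sorted ltn (map val t) then G (map val t) else 0).

(** Among the rearrangements of an increasing sequence only the identity is increasing, so a single
    term survives, and k! cancels the weight. *)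
Lemma entry_form_of n k G s : s \in subsets k (iota 0 n.+1) ->
  entry (form_of n k G) s = G s.
Proof.
move=> /subset_sorted[ss sn sk]; rewrite entryZ.
rewrite (@entry_antisym _ _ _ _ (fun r => if sorted ltn r then G r else 0)) //.
rewrite mulrA divff ?mul1r ?pnatr_eq0 -?lt0n ?fact_gt0 //.
rewrite -(alternating_sum_perm _ sk) (bigD1 1%g) //= odd_perm1 mul1r.
have us : uniq s by rewrite (sorted_uniq ltn_trans ltnn).
have ps (p : 'S_k) : [seq nth 0%N s (p i) | i <- enum 'I_k] =
    mkseq (fun i => nth 0%N s (if insub i is Some j then p j else i)) k.
  rewrite /mkseq -val_enum_ord -map_comp; apply: eq_map => i /=.
  by rewrite valK.
have -> : [seq nth 0%N s ((1 : 'S_k)%g i) | i <- enum 'I_k] = s.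
  rewrite -[RHS](mkseq_nth 0%N) sk /mkseq -val_enum_ord -map_comp.
  by apply: eq_map => i; rewrite /= perm1.
rewrite ss big1 ?addr0 // => p p1; case: ifP => [sp | _]; last by rewrite mulr0.
case/eqP: p1; apply/permP => i; rewrite perm1; apply: val_inj => /=.
have e : [seq nth 0%N s (p i) | i <- enum 'I_k] = s.
  apply: (irr_sorted_eq ltn_trans ltnn) => // x; apply/mapP/idP => [[j _ ->]|xs].
    by rewrite mem_nth ?sk.
  have xk : (index x s < k)%N by rewrite -sk index_mem.
  by exists (p^-1 (Ordinal xk))%g; rewrite ?mem_enum // permKV /= nth_index.
have := congr1 (nth 0%N ^~ i) e.
rewrite (nth_map i) ?size_enum_ord // nth_ord_enum => /eqP.
by rewrite nth_uniq ?sk // => /eqP.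
Qed.

Notation index_set n k := (subsets k (iota 0 n.+1)).

Definition row_of n k (F : kform K n.+1 k) : 'rV[K]_(size (index_set n k)) :=
  \row_i entry F (nth [::] (index_set n k) i).

Fact row_of_linear n k : linear (@row_of n k).
Proof. by move=> a F G; apply/rowP => i; rewrite !mxE entryD entryZ. Qed.
HB.instance Definition _ n k :=
  GRing.isLinear.Build K _ _ _ (@row_of n k) (@row_of_linear n k).

Lemma row_of_inj n k : injective (@row_of n k).
Proof.
move=> F G /rowP FG; apply: entryP => s sn.
have sN : (index s (index_set n k) < size (index_set n k))%N by rewrite index_mem.
by have := FG (Ordinal sN); rewrite !mxE /= nth_index.
Qed.

Lemma dim_kform_le n k : (\dim {:kform K n.+1 k} <= size (index_set n k))%N.
Proof.
rewrite -(@limg_dim_eq _ _ _ (linfun (@row_of n k))).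
  by apply: leq_trans (dimvS (subvf _)) _; rewrite dimvf /dim /= mul1n.
apply/eqP; rewrite -subv0; apply/subvP => F.
rewrite memv_cap memv_ker lfunE /= memv0 => /andP[_ /eqP F0].
by apply/eqP/row_of_inj; rewrite F0 linear0.
Qed.

Definition of_row n k (u : 'rV[K]_(size (index_set n k))) : kform K n.+1 k :=
  form_of n k (fun s => \sum_i u 0 i * (s == nth [::] (index_set n k) i)%:R).

Lemma of_rowK n k : cancel (@of_row n k) (@row_of n k).
Proof.
move=> u; apply/rowP => i; rewrite mxE entry_form_of ?mem_nth //.
rewrite (bigD1 i) //= eqxx mulr1 big1 ?addr0 // => j ji.
rewrite (nth_uniq _ (ltn_ord i) (ltn_ord j)) ?subsets_uniq ?iota_uniq //.
by rewrite val_eqE eq_sym (negPf ji) mulr0.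
Qed.

(** The row space of P consists of eigenvectors of the action on row vectors; a row basis of P lifts
    through [of_row] to a free family of eigenforms. *)
Lemma rank_le_dim_leigenspace n k (T : 'End(kform K n.+1 k))
    (A P : 'M[K]_(size (index_set n k))) a :
  (forall F, row_of (T F) = row_of F *m A) -> P *m A = a *: P ->
  (\rank P <= \dim (passmx.leigenspace T a))%N.
Proof.
move=> TA PA; set r := \rank P.
have PbA : row_base P *m A = a *: row_base P.
  have /submxP[D ->] : (row_base P <= P)%MS by rewrite eq_row_base.
  by rewrite -mulmxA PA scalemxAr.
pose f (i : 'I_r) := of_row (row i (row_base P)).
have ff : free [tuple f i | i < r].
  apply/freeP => c; rewrite (eq_bigr (fun i => c i *: f i)) => [c0|i _]; last first.
    by rewrite -tnth_nth tnth_mktuple.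
  have := congr1 (@row_of n k) c0; rewrite linear0 linear_sum /=.
  rewrite (eq_bigr (fun i => c i *: row i (row_base P))) => [rc0|i _]; last first.
    by rewrite linearZ /= of_rowK.
  have : (\row_i c i) *m row_base P = 0.
    by rewrite mulmx_sum_row -[RHS]rc0; apply: eq_bigr => i _; rewrite mxE.
  rewrite -(mul0mx 1 (row_base P)) => /(row_free_inj (row_base_free P)) /rowP c0' i.
  by have := c0' i; rewrite !mxE.
move: ff; rewrite /free size_tuple => /eqP {1}<-; apply: dimvS; apply/span_subvP => _ /mapP[i _ ->].
apply/leigenspaceP/row_of_inj; rewrite TA [RHS]linearZ /= !of_rowK -row_mul PbA.
exact: linearZ.
Qed.
End Forms.

(** * Integer matrices *)

Fixpoint zaxpy (x : Z) (u v : seq Z) : seq Z :=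
  if (u, v) is (a :: u', b :: v') then Z.add (Z.mul x a) b :: zaxpy x u' v'
  else [::].

(** A row times a matrix, built by scaling whole rows and skipping zero coefficients: cheap as long
    as the left factor is a sparse contraction matrix, hence the right-nested powers below. *)
Fixpoint zcomb n (u : seq Z) (B : seq (seq Z)) : seq Z :=
  if (u, B) is (x :: u', r :: B') then
    if x is Z0 then zcomb n u' B' else zaxpy x r (zcomb n u' B')
  else nseq n Z0.

Definition zmul n (A B : seq (seq Z)) := [seq zcomb n u B | u <- A].

Definition zadd c (A B : seq (seq Z)) := [seq zaxpy c x.1 x.2 | x <- zip A B].

Definition zscalar n c : seq (seq Z) :=
  [seq [seq if i == j then c else Z0 | j <- iota 0 n] | i <- iota 0 n].

Definition ztrace n (A : seq (seq Z)) :=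
  foldr (fun i acc => Z.add (nth Z0 (nth [::] A i) i) acc) Z0 (iota 0 n).

Definition znull (A : seq (seq Z)) := all (all (Z.eqb Z0)) A.

Definition zsized m n (A : seq (seq Z)) :=
  size A = m /\ {in A, forall r, size r = n}.

Definition signed_count (l : seq (bool * seq nat)) s : Z :=
  foldr (fun x acc => if x.2 == s then (if x.1 then Z.pred acc else Z.succ acc)
                      else acc) Z0 l.

(** Rows are indexed by components of the image and columns by those of the argument. It thus acts
    on columns, which explains the transposes once forms are row vectors. *)
Definition contraction_matrix T p k l : seq (seq Z) :=
  [seq map (signed_count t) (subsets k (iota 0 8))
  | t <- map (contraction_terms T p) (subsets l (iota 0 8))].

Section Matrices.
Variable K : numFieldType.

Definition zval (z : Z) : K := (int_of_Z z)%:~R.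

Lemma zvalD x y : zval (Z.add x y) = zval x + zval y.
Proof. by rewrite /zval -intrD -raddfD. Qed.

Lemma zvalM x y : zval (Z.mul x y) = zval x * zval y.
Proof. by rewrite /zval -intrM -rmorphM. Qed.

Definition zmx m n (A : seq (seq Z)) : 'M[K]_(m, n) :=
  \matrix_(i, j) zval (nth Z0 (nth [::] A i) j).

Lemma size_zaxpy x u v : size u = size v -> size (zaxpy x u v) = size v.
Proof. by elim: u v => [|a u IHu] [|b v] //= [/IHu->]. Qed.

Lemma nth_zaxpy x u v i : size u = size v -> 
  zval (nth Z0 (zaxpy x u v) i) = zval x * zval (nth Z0 u i) + zval (nth Z0 v i).
Proof.
elim: u v i => [|a u IHu] [|b v] [|i] //= => [_|_|_|[/IHu->]//].
- by rewrite mulr0 addr0.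
- by rewrite mulr0 addr0.
by rewrite zvalD zvalM.
Qed.

Lemma size_zcomb n u B : {in B, forall r, size r = n} -> size (zcomb n u B) = n.
Proof.
elim: B u => [|r B IHB] [|x u] //= Bn; rewrite ?size_nseq //.
have rn : size r = n by rewrite Bn ?mem_head.
have IH : size (zcomb n u B) = n by apply: IHB => y yB; rewrite Bn ?inE ?yB ?orbT.
by case: x => // y; rewrite size_zaxpy IH.
Qed.

Lemma nth_zcomb n u B i : {in B, forall r, size r = n} -> size u = size B ->
  zval (nth Z0 (zcomb n u B) i) =
  \sum_(j < size B) zval (nth Z0 u j) * zval (nth Z0 (nth [::] B j) i).
Proof.
elim: B u => [|r B IHB] [|x u] //= Bn => [_|[uB]].
  by rewrite nth_nseq if_same big_ord0.
have rn : size r = n by rewrite Bn ?mem_head.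
have Bn' : {in B, forall r, size r = n} by move=> y yB; rewrite Bn ?inE ?yB ?orbT.
rewrite big_ord_recl /= -IHB //; case: x => [|y|y].
- by rewrite mul0r add0r.
- by rewrite nth_zaxpy // size_zcomb.
- by rewrite nth_zaxpy // size_zcomb.
Qed.

Lemma zmxM m n p A B : zsized m n A -> zsized n p B ->
  zmx m p (zmul p A B) = zmx m n A *m zmx n p B.
Proof.
move=> [Am An] [Bn Bp]; apply/matrixP => i j; rewrite !mxE.
rewrite (nth_map [::]) ?Am // nth_zcomb //; last by rewrite An ?Bn ?mem_nth ?Am.
by rewrite Bn; apply: eq_bigr => k _; rewrite !mxE.
Qed.

Lemma zsizedM m n p A B : zsized m n A -> zsized n p B -> zsized m p (zmul p A B).
Proof.
move=> [Am An] [Bn Bp]; split; first by rewrite size_map.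
by move=> _ /mapP[u uA ->]; apply: size_zcomb.
Qed.

Lemma zmxD m n c A B : zsized m n A -> zsized m n B ->
  zmx m n (zadd c A B) = zval c *: zmx m n A + zmx m n B.
Proof.
move=> [Am An] [Bm Bn]; apply/matrixP => i j; rewrite !mxE.
rewrite (nth_map ([::], [::])) ?size_zip ?Am ?Bm ?minnn // nth_zip ?Am //=.
by rewrite nth_zaxpy // An ?Bn // mem_nth ?Am ?Bm.
Qed.

Lemma zsizedD m n c A B : zsized m n A -> zsized m n B -> zsized m n (zadd c A B).
Proof.
move=> [Am An] [Bm Bn]; split; first by rewrite size_map size_zip Am Bm minnn.
move=> _ /mapP[[u v] uv ->] /=.
have /= uA := map_f fst uv; have /= vB := map_f snd uv.
rewrite -!/(unzip1 _) -!/(unzip2 _) unzip1_zip ?unzip2_zip ?Am ?Bm // in uA vB.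
by rewrite size_zaxpy (Bn _ vB) ?(An _ uA).
Qed.

Lemma zmx_scalar n c : zmx n n (zscalar n c) = (zval c)%:M.
Proof.
apply/matrixP => i j; rewrite !mxE (nth_map 0%N) ?size_iota // (nth_map 0%N) ?size_iota //.
by rewrite !nth_iota // !add0n val_eqE; case: eqP.
Qed.

Lemma zsized_scalar n c : zsized n n (zscalar n c).
Proof.
split; first by rewrite size_map size_iota.
by move=> _ /mapP[i _ ->]; rewrite size_map size_iota.
Qed.

Lemma zmx_trace n A : \tr (zmx n n A) = zval (ztrace n A).
Proof.
transitivity (\sum_(i <- iota 0 n) zval (nth Z0 (nth [::] A i) i)).
  by rewrite sum_iota; apply: eq_bigr => i _; rewrite mxE.
rewrite /ztrace; elim: (iota 0 n) => [|i l IHl]; first by rewrite big_nil.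
by rewrite big_cons /= zvalD IHl.
Qed.

Lemma zmx_null m n A : znull A -> zmx m n A = 0.
Proof.
move=> /allP A0; apply/matrixP => i j; rewrite !mxE.
have [iA|iA] := ltnP i (size A); last by rewrite (nth_default _ iA) nth_nil.
have /allP r0 := A0 _ (mem_nth [::] iA).
have [jr|jr] := ltnP j (size (nth [::] A i)); last by rewrite nth_default.
by have := r0 _ (mem_nth Z0 jr); case: (nth Z0 _ j).
Qed.

Lemma zval_signed_count l s :
  zval (signed_count l s) = \sum_(x <- l) (-1) ^+ x.1 * (x.2 == s)%:R.
Proof.
elim: l => [|[b t] l IHl]; first by rewrite big_nil.
rewrite big_cons /=; case: eqP => _; last by rewrite mulr0 add0r.
rewrite mulr1 -IHl; case: b.
  by rewrite -[Z.pred _]/(Z.add _ (Z.neg xH)) zvalD addrC.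
by rewrite -[Z.succ _]/(Z.add _ (Z.pos xH)) zvalD addrC.
Qed.

Lemma eval_signed_count (l : seq (bool * seq nat)) (F : seq nat -> K) B :
  uniq B -> {in l, forall x, x.2 \in B} ->
  eval F l = \sum_(i < size B) zval (signed_count l (nth [::] B i)) * F (nth [::] B i).
Proof.
move=> uB lB; under eq_bigr => i _ do rewrite zval_signed_count big_distrl.
rewrite exchange_big; apply: eq_big_seq => x xl /=.
have xB : (index x.2 B < size B)%N by rewrite index_mem lB.
rewrite (bigD1 (Ordinal xB)) //= nth_index ?lB // eqxx mulr1 big1 ?addr0 // => i iB.
case: eqP => [xi | _]; last by rewrite mulr0 mul0r.
by case/eqP: iB; apply: val_inj; rewrite /= xi index_uniq.
Qed.

Lemma zsized_contraction T p k l : zsized (size (subsets l (iota 0 8)))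
  (size (subsets k (iota 0 8))) (contraction_matrix T p k l).
Proof.
by split; [rewrite !size_map | move=> _ /mapP[t _ ->]; rewrite size_map].
Qed.

Lemma row_of_contraction T p k l (F : kform K 8 k) (G : kform K 8 l) c :
  {in subsets l (iota 0 8), forall s, table_ok 8 k (contraction_terms T p s)} ->
  {in subsets l (iota 0 8), forall s,
    entry G s = c * eval (entry F) (contraction_terms T p s)} ->
  row_of G = row_of F *m (c *: (zmx _ _ (contraction_matrix T p k l))^T).
Proof.
move=> Tok GF; apply/rowP => j; set s := nth [::] (subsets l (iota 0 8)) j.
have sl : s \in subsets l (iota 0 8) by apply: mem_nth.
rewrite mxE -/s GF // -scalemxAr !mxE.
rewrite (@eval_signed_count _ _ (subsets k (iota 0 8))) ?subsets_uniq ?iota_uniq //.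
  congr (_ * _); apply: eq_bigr => i _; rewrite !mxE mulrC; congr (_ * zval _).
  rewrite (nth_map [::]) ?size_map // (nth_map [::]) // (nth_map [::]) //.
move=> x /(allP (Tok s sl)) /and3P[? ? /eqP ?]; exact: sorted_subset.
Qed.

End Matrices.

(** * Spectra of the operators on R^8 *)

Local Notation zpos n := (Z.pos n%positive).
Local Notation zneg n := (Z.neg n%positive).
Local Notation N3 := (size (subsets 3 (iota 0 8))).
Local Notation N4 := (size (subsets 4 (iota 0 8))).
Local Notation N5 := (size (subsets 5 (iota 0 8))).
Local Notation Z3 := (contraction_matrix Theta_table 2 3 3).
Local Notation Z4 := (contraction_matrix Theta_table 2 4 4).
Local Notation Zd := (contraction_matrix Theta_table 1 5 3).
Local Notation Zdt := (contraction_matrix Theta_table 3 3 5).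

(** The polynomials are (x + 6)(x - 1) = x^2 + 5 x - 6 and x (x + 12)(x + 6)(x - 2) = x^4 + 16 x^3 +
    36 x^2 - 144 x. The middle relation reads [Zd] [Zdt] = 5 [Z3] - 6. *)
Lemma contraction_identities :
  [/\ znull (zadd (zpos 5) Z3 (zadd (zpos 1) (zmul N3 Z3 Z3) (zscalar N3 (zneg 6)))),
      znull (zadd (zneg 5) Z3 (zadd (zpos 1) (zmul N3 Zd Zdt) (zscalar N3 (zpos 6)))) &
      znull (zadd (zpos 16) (zmul N4 Z4 (zmul N4 Z4 Z4)) (zadd (zpos 36) (zmul N4 Z4 Z4)
        (zadd (zneg 144) Z4 (zmul N4 Z4 (zmul N4 Z4 (zmul N4 Z4 Z4))))))].
Proof. by split; vm_compute. Qed.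

(** Together with the sizes 56 and 70, these power sums determine the multiplicities of the two and
    four roots. *)
Lemma contraction_traces :
  [/\ ztrace N3 Z3 = Z0, ztrace N4 Z4 = Z0,
      ztrace N4 (zmul N4 Z4 Z4) = zpos 504 &
      ztrace N4 (zmul N4 Z4 (zmul N4 Z4 Z4)) = zneg 3024].
Proof. by split; vm_compute. Qed.

Section Polynomials.
Variables (K : numFieldType) (m n : nat) (A B C : seq (seq Z)).
Hypotheses (sA : zsized n n A) (sB : zsized n m B) (sC : zsized m n C).
Local Notation M := (zmx K n n A).

Lemma zmx_quadratic a b :
  znull (zadd a A (zadd (zpos 1) (zmul n A A) (zscalar n b))) ->
  zval K a *: M + (M *m M + (zval K b)%:M) = 0.
Proof.
have sb := zsized_scalar n b; have s2 := zsizedM sA sA.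
move=> /(zmx_null K n n) <-; rewrite (zmxD _ _ sA (zsizedD _ s2 sb)).
by rewrite (zmxD _ _ s2 sb) (zmxM _ sA sA) zmx_scalar scale1r.
Qed.

Lemma zmx_product a b :
  znull (zadd a A (zadd (zpos 1) (zmul n B C) (zscalar n b))) ->
  zval K a *: M + (zmx K n m B *m zmx K m n C + (zval K b)%:M) = 0.
Proof.
have sb := zsized_scalar n b; have s2 := zsizedM sB sC.
move=> /(zmx_null K n n) <-; rewrite (zmxD _ _ sA (zsizedD _ s2 sb)).
by rewrite (zmxD _ _ s2 sb) (zmxM _ sB sC) zmx_scalar scale1r.
Qed.

Lemma zmx_quartic a b c :
  znull (zadd a (zmul n A (zmul n A A)) (zadd b (zmul n A A)
          (zadd c A (zmul n A (zmul n A (zmul n A A)))))) ->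
  zval K a *: (M *m (M *m M)) + (zval K b *: (M *m M) +
    (zval K c *: M + M *m (M *m (M *m M)))) = 0.
Proof.
have s2 := zsizedM sA sA; have s3 := zsizedM sA s2; have s4 := zsizedM sA s3.
move=> /(zmx_null K n n) <-.
rewrite (zmxD _ _ s3 (zsizedD _ s2 (zsizedD _ sA s4))).
rewrite (zmxD _ _ s2 (zsizedD _ sA s4)) (zmxD _ _ sA s4).
by rewrite (zmxM _ sA s3) (zmxM _ sA s2) (zmxM _ sA sA).
Qed.

Lemma zmx_trace_square : \tr (M *m M) = zval K (ztrace n (zmul n A A)).
Proof. by rewrite -zmx_trace (zmxM _ sA sA). Qed.

Lemma zmx_trace_cube :
  \tr (M *m (M *m M)) = zval K (ztrace n (zmul n A (zmul n A A))).
Proof. by rewrite -zmx_trace (zmxM _ sA (zsizedM sA sA)) (zmxM _ sA sA). Qed.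

End Polynomials.

Section Projectors.
Variables (K : numFieldType) (n : nat) (B : 'M[K]_n).

(** Q vanishes on the y-eigenvectors of B and acts as x - y on its x-eigenvectors, so that Q Q = (x
    - y) Q and [rank_trace] applies. *)
Lemma quadratic_rank x y (Q := B - y%:M) :
  B *m B = (x + y) *: B - (x * y)%:M ->
  B *m Q = x *: Q /\ (x - y) * (\rank Q)%:R = \tr B - y * n%:R.
Proof.
move=> BB; have BQ : B *m Q = x *: Q.
  rewrite mulmxBr BB mul_mx_scalar.
  by apply/matrixP => i j; rewrite !mxE; case: (i == j); rewrite /= ?mulr1n ?mulr0n; ring.
split=> //; rewrite (rank_trace (c := x - y)).
  by rewrite linearB /= mxtrace_scalar mulr_natr.
by rewrite {1}/Q mulmxBl BQ mul_scalar_mx scalerBl.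
Qed.

(* Here e1, e2 and e3 are the elementary symmetric functions of the three roots
   other than x, so that Q is a multiple of the projector onto the x-eigenspace. *)
Lemma quartic_rank x e1 e2 e3
    (Q := B *m (B *m B) - e1 *: (B *m B) + e2 *: B - e3%:M) :
  B *m (B *m (B *m B)) = (x + e1) *: (B *m (B *m B)) - (x * e1 + e2) *: (B *m B)
    + (x * e2 + e3) *: B - (x * e3)%:M ->
  B *m Q = x *: Q /\
  (x ^+ 3 - e1 * x ^+ 2 + e2 * x - e3) * (\rank Q)%:R =
    \tr (B *m (B *m B)) - e1 * \tr (B *m B) + e2 * \tr B - e3 * n%:R.
Proof.
move=> B4; have BQ : B *m Q = x *: Q.
  rewrite /Q !(mulmxDr, mulmxN) -!scalemxAr mul_mx_scalar B4.
  move: (B *m (B *m B)) (B *m B) => C3 C2.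
  by apply/matrixP => i j; rewrite !mxE; case: (i == j); rewrite /= ?mulr1n ?mulr0n; ring.
(* Q is a monic cubic in B, so B Q = x Q turns Q Q into the value of that cubic at x times Q. *)
split=> //; rewrite (rank_trace (c := x ^+ 3 - e1 * x ^+ 2 + e2 * x - e3)).
  by rewrite /Q !(raddfD, raddfN) /= !mxtraceZ mxtrace_scalar mulr_natr.
rewrite {1}/Q !(mulmxDl, mulNmx) -!scalemxAl mul_scalar_mx -!mulmxA BQ.
rewrite -!scalemxAr BQ -!scalemxAr BQ.
by apply/matrixP => i j; rewrite !mxE; ring.
Qed.

End Projectors.

Section Spectrum.
Variable K : numFieldType.

Local Notation B3 := (zmx K N3 N3 Z3).
Local Notation B4 := (zmx K N4 N4 Z4).
Local Notation D := (zmx K N3 N5 Zd).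
Local Notation Dt := (zmx K N5 N3 Zdt).

Lemma zval_pos n : zval K (Z.pos n) = (Pos.to_nat n)%:R.
Proof. by []. Qed.

Lemma zval_neg n : zval K (Z.neg n) = - (Pos.to_nat n)%:R.
Proof. rewrite /zval /= NegzE prednK ?mulrNz //; lia. Qed.

Lemma index_set_sizes : [/\ N3 = 56%N, N4 = 70%N & size (subsets 5 (iota 0 10)) = 252%N].
Proof. by split; vm_compute. Qed.

Lemma row_of_b3 (F : kform K 8 3) : row_of (b3 F) = row_of F *m ((2 / 3) *: B3^T).
Proof.
have [_ _ _ ok] := contraction_terms_ok.
by apply: row_of_contraction ok _ => s sn; apply: entry_b3.
Qed.

Lemma row_of_b4 (F : kform K 8 4) : row_of (b4 F) = row_of F *m ((1 / 3) *: B4^T).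
Proof.
have [_ ok _ _] := contraction_terms_ok.
by apply: row_of_contraction ok _ => s sn; apply: entry_b4.
Qed.

Lemma row_of_d (F : kform K 8 5) : row_of (d_Theta F) = row_of F *m (2 *: D^T).
Proof.
have [_ _ ok _] := contraction_terms_ok.
by apply: row_of_contraction ok _ => s sn; apply: entry_d.
Qed.

Lemma row_of_dt (F : kform K 8 3) : row_of (dt_Theta F) = row_of F *m ((1 / 10) *: Dt^T).
Proof.
have [ok _ _ _] := contraction_terms_ok.
by apply: row_of_contraction ok _ => s sn; apply: entry_dt.
Qed.

(** Only the sum and product of the roots are prescribed, so the same statement serves whichever
    root is singled out as [x]. *)
Lemma B3_quadratic x y : x + y = - 5 -> x * y = - 6 ->
  B3 *m B3 = (x + y) *: B3 - (x * y)%:M.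
Proof.
move=> -> ->; have [/(zmx_quadratic K (zsized_contraction _ _ _ _)) + _ _] :=
  contraction_identities.
rewrite (zval_pos 5 : _ = 5) (zval_neg 6 : _ = - 6).
(* The concrete matrices are generalized so that the entrywise [ring] meets atoms. *)
move: (B3 *m B3) B3 => C B B0; apply/eqP; rewrite -subr_eq0 -B0; apply/eqP.
by apply/matrixP => i j; rewrite !mxE; case: (i == j); rewrite /= ?mulr1n ?mulr0n; ring.
Qed.

Lemma D_Dt : D *m Dt = 5 *: B3 - 6%:M.
Proof.
have [_ /(zmx_product K (zsized_contraction _ _ _ _) (zsized_contraction _ _ _ _)
  (zsized_contraction _ _ _ _)) + _] := contraction_identities.
rewrite (zval_pos 6 : _ = 6) (zval_neg 5 : _ = - 5).
move: (D *m Dt) B3 => C B B0; apply/eqP; rewrite -subr_eq0 -B0; apply/eqP.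
by apply/matrixP => i j; rewrite !mxE; case: (i == j); rewrite /= ?mulr1n ?mulr0n; ring.
Qed.

Lemma B4_quartic x e1 e2 e3 : x + e1 = - 16 -> x * e1 + e2 = 36 ->
    x * e2 + e3 = 144 -> x * e3 = 0 ->
  B4 *m (B4 *m (B4 *m B4)) = (x + e1) *: (B4 *m (B4 *m B4))
    - (x * e1 + e2) *: (B4 *m B4) + (x * e2 + e3) *: B4 - (x * e3)%:M.
Proof.
move=> -> -> -> ->; have [_ _ /(zmx_quartic K (zsized_contraction _ _ _ _))] :=
  contraction_identities.
rewrite (zval_pos 16 : _ = 16) (zval_pos 36 : _ = 36) (zval_neg 144 : _ = - 144).
move: (B4 *m (B4 *m (B4 *m B4))) (B4 *m (B4 *m B4)) (B4 *m B4) B4 => C4 C3 C2 B B0.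
rewrite -scalemx1 scale0r subr0; apply/eqP; rewrite -subr_eq0 -B0; apply/eqP.
by apply/matrixP => i j; rewrite !mxE; ring.
Qed.

(** The weights 2 and 1/10 multiply to 1/5, and (5 M3 - 6) / 5 = M3 - 6/5 with M3 acting as 3/2
    [b3]. *)
Lemma d_dt (F : kform K 8 3) : d_Theta (dt_Theta F) = (3 / 2) *: b3 F - (6 / 5) *: F.
Proof.
apply: row_of_inj; rewrite linearB !linearZ /= row_of_d row_of_dt row_of_b3.
rewrite -mulmxA -scalemxAl -!scalemxAr -trmx_mul D_Dt linearB /= tr_scalar_mx.
rewrite [(_ *: _)^T]linearZ /= mulmxBr mul_mx_scalar -scalemxAr.
move: (row_of F *m B3^T) (row_of F) => u v.
by apply/rowP => i; rewrite !mxE; field.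
Qed.

Lemma rank_le_dim_transpose k (T : 'End(kform K 8 k)) N
    (B Q : 'M[K]_(size (subsets k (iota 0 8)))) c x :
  (forall F, row_of (T F) = row_of F *m (c *: B^T)) -> B *m Q = x *: Q ->
  \rank Q = N -> (N <= \dim (passmx.leigenspace T (c * x)))%N.
Proof.
move=> TB BQ <-; rewrite -mxrank_tr; apply: (rank_le_dim_leigenspace TB).
by rewrite -scalemxAr -trmx_mul BQ linearZ /= scalerA.
Qed.

Lemma eqn_of_mul (c t : K) r m : c != 0 -> c * r%:R = t -> t = c * m%:R -> r = m.
Proof. by move=> c0 <- /(mulfI c0)/eqP; rewrite eqr_nat => /eqP. Qed.

(** With trace 0 in size 56, the ranks solve -7 r = -56 for the root -6 and 7 r = 336 for the root
    1. *)
Lemma dim_Lambda3 :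
  (8 <= \dim (Lambda3 (- 4 : K)))%N /\ (48 <= \dim (Lambda3 (2 / 3 : K)))%N.
Proof.
have tB : \tr B3 = 0.
  by rewrite zmx_trace; have [-> _ _ _] := contraction_traces.
have [n3 _ _] := index_set_sizes; split.
  have [|BQ rQ] := @quadratic_rank K _ B3 (- 6) 1; first by apply: B3_quadratic; ring.
  have -> : - 4 = 2 / 3 * - 6 :> K by field.
  apply: (rank_le_dim_transpose row_of_b3 BQ); apply: eqn_of_mul rQ _.
    by rewrite (_ : - 6 - 1 = - 7) ?oppr_eq0 ?pnatr_eq0 //; ring.
  by rewrite tB n3; ring.
have [|BQ rQ] := @quadratic_rank K _ B3 1 (- 6); first by apply: B3_quadratic; ring.
rewrite -[2 / 3 in leqRHS]mulr1.
apply: (rank_le_dim_transpose row_of_b3 BQ); apply: eqn_of_mul rQ _.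
  by rewrite (_ : 1 - - 6 = 7) ?pnatr_eq0 //; ring.
by rewrite tB n3; ring.
Qed.

(** The first four hypotheses are the Vieta relations of the quartic; [c] is the value at [x] of the
    cubic with the other three roots. The last equation is the trace formula, without an e2 term
    because tr [B4] = 0. *)
Lemma dim_Lambda4_le x e1 e2 e3 c m :
  x + e1 = - 16 -> x * e1 + e2 = 36 -> x * e2 + e3 = 144 -> x * e3 = 0 ->
  x ^+ 3 - e1 * x ^+ 2 + e2 * x - e3 = c%:~R -> c != 0 ->
  - 3024 - e1 * 504 - e3 * 70 = c%:~R * m%:R ->
  (m <= \dim (Lambda4 (x / 3 : K)))%N.
Proof.
move=> h1 h2 h3 h4 xc c0 xm.
have [|BQ rQ] := @quartic_rank K _ B4 x e1 e2 e3; first exact: B4_quartic.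
rewrite [x / 3]mulrC -div1r; apply: (rank_le_dim_transpose row_of_b4 BQ).
apply: eqn_of_mul rQ _; rewrite xc ?intr_eq0 // -xm.
have [_ n4 _] := index_set_sizes; have s4 := zsized_contraction Theta_table 2 4 4.
have [_ z1 z2 z3] := contraction_traces.
rewrite (etrans (zmx_trace_cube K s4) (congr1 (zval K) z3)).
rewrite (etrans (zmx_trace_square K s4) (congr1 (zval K) z2)).
rewrite (etrans (zmx_trace K _ Z4) (congr1 (zval K) z1)) n4.
by rewrite (zval_pos 504 : _ = 504) (zval_neg 3024 : _ = - 3024) mulr0 addr0.
Qed.

(** The arguments are a root among 0, -12, -6, 2, the symmetric functions of the other three, and
    their cubic at that root. The traces -5040, -1008, 2016 and 6048 divided by -144, -1008, 288 and
    224 give 35, 1, 7 and 27. *)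
Lemma dim_Lambda4 :
  [/\ (35 <= \dim (Lambda4 (0 : K)))%N, (1 <= \dim (Lambda4 (- 4 : K)))%N,
      (7 <= \dim (Lambda4 (- 2 : K)))%N & (27 <= \dim (Lambda4 (2 / 3 : K)))%N].
Proof.
split.
- rewrite -(mul0r (3^-1)).
  by apply: (@dim_Lambda4_le 0 (- 16) 36 144 (- 144)); rewrite //; ring.
- have -> : - 4 = - 12 / 3 :> K by field.
  by apply: (@dim_Lambda4_le _ (- 4) (- 12) 0 (- 1008)); rewrite //; ring.
- have -> : - 2 = - 6 / 3 :> K by field.
  by apply: (@dim_Lambda4_le _ (- 10) (- 24) 0 288); rewrite //; ring.
- by apply: (@dim_Lambda4_le _ (- 18) 72 0 224); rewrite //; ring.
Qed.

End Spectrum.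

(** * The decomposition of five-forms *)

Section TensorProducts.
Variable K : numFieldType.

Lemma push_linear m n k (h : 'I_m -> 'I_n) : linear (@push K m n k h).
Proof.
apply: antisym_linear => a u v t; rewrite big_distrr -big_split /=.
by apply: eq_bigr => w _; rewrite componentD componentZ.
Qed.

Lemma otimes_linear p q (F : kform K 8 p) : linear (@otimes K p q F).
Proof.
move=> a V W; rewrite /otimes push_linear /wedge scalerA mulrC -scalerA -scalerDr.
congr (_ *: _); apply: (@antisym_linear _ (kform K 10 q) _ _ (fun (V : kform K 10 q) t =>
  push (@lshift 8 2) F _ * V _)) => {V W} b V W t.
by rewrite componentD componentZ mulrDr mulrCA.
Qed.
HB.instance Definition _ p q F :=
  GRing.isLinear.Build K _ _ _ (@otimes K p q F) (otimes_linear F).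

Lemma memv_otimes p q (U : {vspace kform K 8 p}) (W : {vspace kform K 2 q}) F V :
  F \in U -> V \in W -> F \ox V \in (U \ox W)%VS.
Proof.
move=> FU VW; rewrite (coord_vbasis FU) (coord_vbasis VW).
rewrite -[_ \ox _]/(otimesr_fun _ _) linear_sum /=; apply: memv_suml => i _.
rewrite linearZ /=; apply: rpredZ; rewrite /otimesr_fun linear_sum /=.
apply: memv_suml => j _; rewrite linearZ /=; apply: rpredZ; apply: memv_span.
by apply/allpairsP; exists ((vbasis U)`_i, (vbasis W)`_j); rewrite !mem_nth ?size_tuple.
Qed.

Lemma otimesv_sub p q (U : {vspace kform K 8 p}) (W : {vspace kform K 2 q})
    (X : {vspace kform K 10 (p + q)}) :
  (forall F V, F \in U -> V \in W -> F \ox V \in X) -> ((U \ox W)%VS <= X)%VS.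
Proof.
move=> UWX; apply/span_subvP => _ /allpairsP[[F V] [/= FU VW ->]].
by apply: UWX; apply: vbasis_mem.
Qed.

Lemma otimesrE p q (V : kform K 2 q) (F : kform K 8 p) : otimesr p V F = F \ox V.
Proof. by rewrite /otimesr lfunE. Qed.

(** Coordinates on the five-forms of K^10: splitting the middle summand along e_9 and e_10 leaves
    four forms on K^8, unique by [assemble_inj]. *)
Definition assemble (A : kform K 8 5) (B0 B1 : kform K 8 4) (C : kform K 8 3) :
    kform K 10 5 :=
  (A \ox Defs.one K 2 : kform K 10 5) + (B0 \ox e K 0 : kform K 10 5) +
  (B1 \ox e K 1 : kform K 10 5) + (C \ox eps K : kform K 10 5).

Lemma entry_assemble A B0 B1 C (X := assemble A B0 B1 C) :
  [/\ {in subsets 5 (iota 0 8), forall u, entry X u = entry A u},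
      {in subsets 4 (iota 0 8), forall u, entry X (u ++ [:: 8]%N) = entry B0 u},
      {in subsets 4 (iota 0 8), forall u, entry X (u ++ [:: 9]%N) = entry B1 u} &
      {in subsets 3 (iota 0 8), forall u, entry X (u ++ [:: 8; 9]%N) = entry C u}].
Proof.
rewrite {}/X /assemble; split=> u /subset_sorted[su u8 uk].
- rewrite -{1}[u]cats0 -[[::]]/(map (addn 8) [::]) !entryD.
  rewrite (entry_otimes A) ?uk // (entry_otimes B0) ?uk // (entry_otimes B1) ?uk //.
  by rewrite (entry_otimes C) ?uk //= entry_one mulr1 !addr0.
- rewrite -[[:: 8]%N]/(map (addn 8) [:: 0]%N) !entryD.
  rewrite (entry_otimes A) ?uk // (entry_otimes B0) ?uk // (entry_otimes B1) ?uk //.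
  by rewrite (entry_otimes C) ?uk //= (entry_e K 0 0) (entry_e K 1 0) /= mulr1 mulr0 !addr0 add0r.
- rewrite -[[:: 9]%N]/(map (addn 8) [:: 1]%N) !entryD.
  rewrite (entry_otimes A) ?uk // (entry_otimes B0) ?uk // (entry_otimes B1) ?uk //.
  by rewrite (entry_otimes C) ?uk //= (entry_e K 0 1) (entry_e K 1 1) /= mulr1 mulr0 !addr0 !add0r.
- rewrite -[[:: 8; 9]%N]/(map (addn 8) [:: 0; 1]%N) !entryD.
  rewrite (entry_otimes A) ?uk // (entry_otimes B0) ?uk // (entry_otimes B1) ?uk //.
  by rewrite (entry_otimes C) ?uk //= entry_eps mulr1 !add0r.
Qed.

Lemma assemble_inj A B0 B1 C A' B0' B1' C' :
  assemble A B0 B1 C = assemble A' B0' B1' C' ->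
  [/\ A = A', B0 = B0', B1 = B1' & C = C'].
Proof.
move=> e; have [a b0 b1 c] := entry_assemble A B0 B1 C.
have [a' b0' b1' c'] := entry_assemble A' B0' B1' C'.
split; apply: entryP => u uk; [rewrite -a // -a' // | rewrite -b0 // -b0' // |
  rewrite -b1 // -b1' // | rewrite -c // -c' //]; by rewrite e.
Qed.

Lemma assemble_surj X : exists A B0 B1 C, X = assemble A B0 B1 C.
Proof.
exists (form_of 7 5 (entry X)), (form_of 7 4 (fun u => entry X (u ++ [:: 8]%N))),
  (form_of 7 4 (fun u => entry X (u ++ [:: 9]%N))),
  (form_of 7 3 (fun u => entry X (u ++ [:: 8; 9]%N))).
set A := form_of _ _ _; set B0 := form_of _ _ _; set B1 := form_of _ _ _.
set C := form_of _ _ _.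
have [a b0 b1 c] := entry_assemble A B0 B1 C.
apply: entryP => s sn; case: (block_indexP sn) => u uk.
- by rewrite a // entry_form_of.
- by rewrite b0 // entry_form_of.
- by rewrite b1 // entry_form_of.
- by rewrite c // entry_form_of.
Qed.

End TensorProducts.

Section BlockEigenspaces.
Variable K : numFieldType.

Lemma kform0E (c : kform K 2 0) : c = entry c [::] *: Defs.one K 2.
Proof.
by apply: entryP => s; rewrite inE => /eqP->; rewrite entryZ entry_one mulr1.
Qed.

Lemma kform1E (V : kform K 2 1) :
  V = entry V [:: 0]%N *: e K 0 + entry V [:: 1]%N *: e K 1.
Proof.
apply: entryP => s; rewrite !inE => /orP[] /eqP->; rewrite entryD !entryZ.
  by rewrite (entry_e K 0 0) (entry_e K 1 0) /= mulr1 mulr0 addr0.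
by rewrite (entry_e K 0 1) (entry_e K 1 1) /= mulr1 mulr0 add0r.
Qed.

Lemma kform2E (W : kform K 2 2) : W = entry W [:: 0; 1]%N *: eps K.
Proof.
by apply: entryP => s; rewrite inE => /eqP->; rewrite entryZ entry_eps mulr1.
Qed.

Lemma otimes0l p q (V : kform K 2 q) : (0 : kform K 8 p) \ox V = 0.
Proof. exact: (linear0 (otimesr_fun V)). Qed.

Lemma otimes5E (A : kform K 8 5) (c : kform K 2 0) :
  A \ox c = assemble (entry c [::] *: A) 0 0 0.
Proof.
by rewrite /assemble !otimes0l !addr0 {1}[c]kform0E linearZ /= -otimesZ.
Qed.

Lemma otimes4E (B : kform K 8 4) (V : kform K 2 1) :
  B \ox V = assemble 0 (entry V [:: 0]%N *: B) (entry V [:: 1]%N *: B) 0.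
Proof.
rewrite /assemble !otimes0l addr0 add0r {1}[V]kform1E linearD !linearZ /=.
by rewrite -!otimesZ.
Qed.

Lemma otimes3E (C : kform K 8 3) (W : kform K 2 2) :
  C \ox W = assemble 0 0 0 (entry W [:: 0; 1]%N *: C).
Proof.
by rewrite /assemble !otimes0l !add0r {1}[W]kform2E linearZ /= -otimesZ.
Qed.

Lemma assemble0 : assemble 0 0 0 0 = 0 :> kform K 10 5.
Proof. by rewrite /assemble !otimes0l !addr0. Qed.

Lemma mem_block5 X : X \in ({:kform K 8 5} \ox {:kform K 2 0})%VS ->
  exists A, X = assemble A 0 0 0.
Proof.
have /subvP sub : (({:kform K 8 5} \ox {:kform K 2 0})%VS <=
    limg (otimesr 5 (Defs.one K 2)))%VS.
  apply: otimesv_sub => F c _ _; rewrite [c]kform0E linearZ; apply: rpredZ.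
  by apply/memv_imgP; exists F; rewrite ?memvf ?otimesrE.
move=> /sub /memv_imgP[A _ ->]; exists A.
by rewrite otimesrE otimes5E entry_one scale1r.
Qed.

Lemma mem_block4 X : X \in ({:kform K 8 4} \ox {:kform K 2 1})%VS ->
  exists B0 B1, X = assemble 0 B0 B1 0.
Proof.
have /subvP sub : (({:kform K 8 4} \ox {:kform K 2 1})%VS <=
    limg (otimesr 4 (e K 0%R)) + limg (otimesr 4 (e K 1%R)))%VS.
  apply: otimesv_sub => F V _ _; rewrite [V]kform1E linearD !linearZ.
  by apply: memv_add; apply: rpredZ; apply/memv_imgP; exists F; rewrite ?memvf ?otimesrE.
move=> /sub /memv_addP[_ /memv_imgP[B0 _ ->] [_ /memv_imgP[B1 _ ->] ->]].
by exists B0, B1; rewrite !otimesrE /assemble !otimes0l addr0 add0r.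
Qed.

Lemma mem_block3 X : X \in ({:kform K 8 3} \ox {:kform K 2 2})%VS ->
  exists C, X = assemble 0 0 0 C.
Proof.
have /subvP sub : (({:kform K 8 3} \ox {:kform K 2 2})%VS <=
    limg (otimesr 3 (eps K)))%VS.
  apply: otimesv_sub => F c _ _; rewrite [c]kform2E linearZ; apply: rpredZ.
  by apply/memv_imgP; exists F; rewrite ?memvf ?otimesrE.
move=> /sub /memv_imgP[C _ ->]; exists C.
by rewrite otimesrE otimes3E entry_eps scale1r.
Qed.

(** Directness is the uniqueness of the [assemble] coordinates, spanning is their existence. *)
Lemma block_decomposition :
  let L50 := (({:kform K 8 5} \ox {:kform K 2 0})%VS : {vspace kform K 10 5}) in
  let L41 := (({:kform K 8 4} \ox {:kform K 2 1})%VS : {vspace kform K 10 5}) in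
  let L32 := (({:kform K 8 3} \ox {:kform K 2 2})%VS : {vspace kform K 10 5}) in
  directv (L50 + L41 + L32) /\ (L50 + L41 + L32)%VS = {:kform K 10 5}%VS.
Proof.
move=> L50 L41 L32; split.
  rewrite directv_addE /= directv_addE /= !directv_trivial /=; apply/andP; split.
    apply/eqP/eqP; rewrite -subv0; apply/subvP => X.
    rewrite memv_cap => /andP[/mem_block5[A ->] /mem_block4[B0 [B1]]].
    by move=> /assemble_inj[-> _ _ _]; rewrite assemble0 mem0v.
  apply/eqP/eqP; rewrite -subv0; apply/subvP => X.
  rewrite memv_cap => /andP[/memv_addP[_ /mem_block5[A ->] [_ /mem_block4[B0 [B1 ->]] ->]]].
  move=> /mem_block3[C]; rewrite /assemble !otimes0l !(addr0, add0r) addrA => e.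
  have /assemble_inj[-> -> -> _] : assemble A B0 B1 0 = assemble 0 0 0 C.
    by rewrite /assemble !otimes0l !(addr0, add0r).
  by rewrite !otimes0l !addr0 mem0v.
apply/eqP; rewrite eqEsubv subvf; apply/subvP => X _.
have [A [B0 [B1 [C ->]]]] := assemble_surj X.
rewrite /assemble -(addrA (A \ox _ : kform K 10 5)).
have memF p q (F : kform K 8 p) (V : kform K 2 q) :
  F \ox V \in ({:kform K 8 p} \ox {:kform K 2 q})%VS by apply: memv_otimes; apply: memvf.
apply: memv_add; last exact: (memF _ _ C (eps K)).
apply: memv_add; first exact: (memF _ _ A (Defs.one K 2)).
by apply: rpredD; [exact: (memF _ _ B0 (e K 0)) | exact: (memF _ _ B1 (e K 1))].
Qed.

Lemma b_hat_otimes4 (F : kform K 8 4) (V : kform K 2 1) :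
  b_hat (F \ox V) = (9 / 5) *: (b4 F \ox star1 V : kform K 10 5).
Proof.
have := b_hat_blocks 0 0 F V 0 0.
by rewrite !(otimes0l, linear0) !(addr0, add0r).
Qed.

Lemma b_hat_graph c (F : kform K 8 3) :
  b_hat ((c *: dt_Theta F \ox Defs.one K 2 : kform K 10 5) + (F \ox eps K : kform K 10 5)) =
  6 *: (dt_Theta F \ox Defs.one K 2 : kform K 10 5) +
  (3 / 10 * c) *: (d_Theta (dt_Theta F) \ox eps K : kform K 10 5).
Proof.
have := b_hat_blocks (c *: dt_Theta F) (Defs.one K 2) 0 0 F (eps K).
rewrite otimes0l addr0 => ->; rewrite star2E star0E entry_one entry_eps !scale1r.
by rewrite !linear0 addr0 [d_Theta _]linearZ /= otimesZ -(scalerA (3 / 10) c).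
Qed.

Definition graph_hom (c : K) :=
  c *: (otimesr 5 (Defs.one K 2) \o @dt_Theta K)%VF + otimesr 3 (eps K).

Lemma graph_homE c (F : kform K 8 3) :
  graph_hom c F = assemble (c *: dt_Theta F) 0 0 F.
Proof.
rewrite /graph_hom add_lfunE scale_lfunE comp_lfunE !otimesrE /assemble !otimes0l !addr0.
by rewrite otimesZ.
Qed.

(** The two hypotheses are the five-form and the three-form component of the eigenvector
    equation. *)
Lemma graph_sub (c beta x : K) : x * c = 6 -> 3 / 10 * c * (3 / 2 * beta - 6 / 5) = x ->
  (graph c (Lambda3 beta) <= passmx.leigenspace b_hat x)%VS.
Proof.
move=> xc cx; apply/subvP => _ /memv_imgP[F /leigenspaceP bF ->]; apply/leigenspaceP.
rewrite -/(graph_hom c) graph_homE /assemble !otimes0l !addr0 b_hat_graph d_dt bF.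
rewrite (scalerA (3 / 2) beta F) -scalerBl !otimesZ scalerDr.
move: (dt_Theta F \ox _) (F \ox _) => Y Z.
by rewrite scalerA cx scalerA xc.
Qed.

Lemma dim_graph (c : K) U : \dim (graph c U) = \dim U.
Proof.
apply: (@limg_dim_eq _ _ _ (graph_hom c)).
apply/eqP; rewrite -subv0; apply/subvP => F.
rewrite memv_cap memv_ker memv0 graph_homE -assemble0 => /andP[_ /eqP].
by move=> /assemble_inj[_ _ _ ->].
Qed.

Lemma otimesv4_sub (beta a x : K) : 9 / 5 * beta * a = x ->
  ((Lambda4 beta \ox passmx.leigenspace star1 a)%VS <=
    (passmx.leigenspace b_hat x : {vspace kform K 10 5}))%VS.
Proof.
move=> <-; apply: otimesv_sub => F V /leigenspaceP bF /leigenspaceP sV.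
apply/leigenspaceP; rewrite b_hat_otimes4 bF sV otimesZ.
have -> : F \ox (a *: V) = a *: (F \ox V) by apply: linearZ.
by move: (F \ox V) => Y; rewrite !scalerA.
Qed.

Section Line.
Variable a : K.
Hypothesis aa : a * a = - 1.

(** It spans the a-eigenspace of the Hodge operator: * (e_9 - a e_10) = e_10 + a e_9 = a (e_9 - a
    e_10), as a^2 = -1. *)
Definition line_form : kform K 2 1 := e K 0 - a *: e K 1.

Lemma entry_line0 : entry line_form [:: 0]%N = 1.
Proof.
rewrite entryD -scaleN1r !entryZ (entry_e K 0 0) (entry_e K 1 0) /=.
by rewrite !mulr0 addr0.
Qed.

Lemma entry_line1 : entry line_form [:: 1]%N = - a.
Proof.
rewrite entryD -scaleN1r !entryZ (entry_e K 0 1) (entry_e K 1 1) /=.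
by rewrite mulr1 mulN1r add0r.
Qed.

Lemma leigenspace_star1 (V : kform K 2 1) :
  reflect (V = entry V [:: 0]%N *: line_form) (V \in passmx.leigenspace star1 a).
Proof.
apply: (iffP (leigenspaceP _ _ _)) => [|->]; last first.
  rewrite linearZ /= [RHS]scalerA [a * _]mulrC -scalerA; congr (_ *: _).
  rewrite star1E entry_line0 entry_line1 scale1r scaleNr opprK /line_form.
  by rewrite scalerBr scalerA aa scaleN1r opprK addrC.
(* The e_9 component of * V = a V already determines V: it reads - V_1 = a V_0. *)
rewrite star1E => /(congr1 (fun W => entry W [:: 0]%N)).
rewrite entryD -scaleN1r !entryZ (entry_e K 1 0) (entry_e K 0 0) /=.
rewrite !mulr1 mulr0 add0r mulN1r => V1.
by rewrite {1}[V]kform1E /line_form scalerBr scalerA mulrC -V1 scaleNr opprK.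
Qed.

Lemma mem_otimesv_line (U : {vspace kform K 8 4}) X :
  X \in (U \ox passmx.leigenspace star1 a)%VS ->
  exists2 F, F \in U & X = assemble 0 F (- a *: F) 0.
Proof.
have /subvP sub : ((U \ox passmx.leigenspace star1 a)%VS <= otimesr 4 line_form @: U)%VS.
  apply: otimesv_sub => F V FU /leigenspace_star1->.
  have -> v : F \ox (v *: line_form) = v *: (F \ox line_form) by apply: linearZ.
  by apply: rpredZ; apply/memv_imgP; exists F; rewrite ?otimesrE.
move=> /sub /memv_imgP[F FU ->]; exists F => //.
by rewrite otimesrE otimes4E entry_line0 entry_line1 scale1r.
Qed.

Lemma dim_otimesv_line (U : {vspace kform K 8 4}) :
  \dim (U \ox passmx.leigenspace star1 a)%VS = \dim U.
Proof.
transitivity (\dim (otimesr 4 line_form @: U)%VS).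
  congr (\dim _); apply/eqP; rewrite eqEsubv; apply/andP; split; apply/subvP => X.
    move=> /mem_otimesv_line[F FU ->]; apply/memv_imgP; exists F => //.
    by rewrite otimesrE otimes4E entry_line0 entry_line1 scale1r.
  move=> /memv_imgP[F FU ->]; rewrite otimesrE; apply: memv_otimes => //.
  by apply/leigenspace_star1; rewrite entry_line0 scale1r.
apply: limg_dim_eq; apply/eqP; rewrite -subv0; apply/subvP => F.
rewrite memv_cap memv_ker memv0 otimesrE otimes4E -assemble0 => /andP[_ /eqP].
by move=> /assemble_inj[_ + _ _]; rewrite entry_line0 scale1r => ->.
Qed.

Lemma graph_otimesv_disjoint c (U : {vspace kform K 8 3}) (U' : {vspace kform K 8 4}) :
  (graph c U :&: (U' \ox passmx.leigenspace star1 a) = 0 :> {vspace kform K 10 5})%VS.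
Proof.
apply/eqP; rewrite -subv0; apply/subvP => X; rewrite memv_cap => /andP[].
move=> /memv_imgP[F _ ->] /mem_otimesv_line[G _].
rewrite -/(graph_hom c) graph_homE => e; have [-> _ _ ->] := assemble_inj e.
by rewrite assemble0 mem0v.
Qed.

End Line.

Lemma otimesv_lines_disjoint a b (U U' : {vspace kform K 8 4}) :
  a * a = - 1 -> b * b = - 1 -> a != b ->
  ((U \ox passmx.leigenspace star1 a) :&: (U' \ox passmx.leigenspace star1 b) = 0
    :> {vspace kform K 10 5})%VS.
Proof.
move=> aa bb ab; apply/eqP; rewrite -subv0; apply/subvP => X; rewrite memv_cap => /andP[].
move=> /(mem_otimesv_line aa)[F _ ->] /(mem_otimesv_line bb)[G _].
move=> /assemble_inj[_ <- /eqP + _]; rewrite -subr_eq0 -scalerBl scaler_eq0.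
rewrite opprK addrC subr_eq0 eq_sym (negPf ab) /= => /eqP->.
by rewrite scaler0 assemble0 mem0v.
Qed.

End BlockEigenspaces.

(** * The eigenspaces in ten dimensions *)

Section Count.
Variables (K : numFieldType) (i : K).
Hypothesis ii : i * i = - 1.

Local Notation E a := (passmx.leigenspace (@b_hat K) a).
Local Notation R_ s := (passmx.leigenspace star1 ((-1) ^+ (s : bool) * i)).

(** All nine eigenvalues are integer multiples of i/5, which reduces their distinctness to that of
    integers. *)
Definition eigenvalue (z : int) : K := z%:~R / 5 * i.

Lemma eigenvalue_inj : injective eigenvalue.
Proof.
have i0 : i != 0.
  by apply/eqP => i0; have /eqP := ii; rewrite i0 mul0r eq_sym oppr_eq0 oner_eq0.
move=> x y /(mulIf i0) /mulIf e; apply: (@intr_inj K); apply: e.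
by rewrite invr_eq0 pnatr_eq0.
Qed.

Lemma signed_eigenvalue (s : bool) (n : nat) :
  (-1) ^+ s * (n%:R / 5) * i = eigenvalue (if s then - n%:Z else n%:Z).
Proof.
rewrite /eigenvalue; case: s => /=; last by rewrite mul1r.
by rewrite expr1 mulN1r rmorphN /= !mulNr.
Qed.

Lemma R_square (s : bool) : ((-1) ^+ s * i) * ((-1) ^+ s * i) = - 1.
Proof. by rewrite mulrACA -expr2 sqrr_sign mul1r ii. Qed.

Lemma zero_eigenspaces :
  [/\ ((Lambda4 0 \ox R_ false)%VS <= E 0)%VS, ((Lambda4 0 \ox R_ true)%VS <= E 0)%VS,
      directv ((Lambda4 0 \ox R_ false)%VS + (Lambda4 0 \ox R_ true)%VS),
      \dim (Lambda4 0 \ox R_ false)%VS = \dim (Lambda4 (0 : K)) &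
      \dim (Lambda4 0 \ox R_ true)%VS = \dim (Lambda4 (0 : K))].
Proof.
split.
- by apply: otimesv4_sub; rewrite mulr0 mul0r.
- by apply: otimesv4_sub; rewrite mulr0 mul0r.
- apply/directv_addP/otimesv_lines_disjoint; try exact: R_square.
  rewrite mul1r mulN1r -subr_eq0 opprK -mulr2n -mulr_natl mulf_eq0 pnatr_eq0 /=.
  by apply/eqP => i0; have /eqP := ii; rewrite i0 mul0r eq_sym oppr_eq0 oner_eq0.
- exact: dim_otimesv_line (R_square _) _.
- exact: dim_otimesv_line (R_square _) _.
Qed.

(** On the middle block the eigenvalue is 9/5 beta times that of the Hodge operator; the negative
    values -4 and -2 reverse the sign, hence [~~ s], while 2/3 keeps it. *)
Lemma signed_eigenspaces (s : bool) :
  [/\ ((Lambda4 (- 4) \ox R_ (~~ s))%VS <= E ((-1) ^+ s * (36 / 5) * i))%VS,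
      (graph (- ((-1) ^+ s * (5 / 3) * i)) (Lambda3 (- 4)) + (Lambda4 (- 2) \ox R_ (~~ s))%VS
        <= E ((-1) ^+ s * (18 / 5) * i))%VS,
      ((Lambda4 (2 / 3) \ox R_ s)%VS <= E ((-1) ^+ s * (6 / 5) * i))%VS &
      (graph (- ((-1) ^+ s * 10 * i)) (Lambda3 (2 / 3)) <= E ((-1) ^+ s * (3 / 5) * i))%VS].
Proof.
have ss : (-1) ^+ s * (-1) ^+ s = 1 :> K by rewrite -expr2 sqrr_sign.
move: ss; rewrite signrN; move: ((-1) ^+ s) => t tt.
have sq : (t * i) * (t * i) = - 1 by rewrite mulrACA tt mul1r ii.
split.
- by apply: otimesv4_sub; field.
- rewrite subv_add; apply/andP; split; last by apply: otimesv4_sub; field.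
  apply: graph_sub.
    by transitivity (- 6 * ((t * i) * (t * i))); [field | rewrite sq; ring].
  by field.
- by apply: otimesv4_sub; field.
- apply: graph_sub.
    by transitivity (- 6 * ((t * i) * (t * i))); [field | rewrite sq; ring].
  by field.
Qed.

Lemma dim_eigenspaces_le l : uniq l ->
  (\sum_(a <- l) \dim (E a) <= 252)%N.
Proof.
move=> /(sum_dim_leigenspace (@b_hat K)) le; apply: leq_trans le _.
by have [_ _ n5] := index_set_sizes; apply: leq_trans (dim_kform_le K 9 5) _; rewrite n5.
Qed.

Lemma dim_claimed :
  (70 <= \dim ((Lambda4 0 \ox R_ false)%VS + (Lambda4 0 \ox R_ true)%VS)%VS)%N /\
  forall s : bool,
  [/\ (1 <= \dim (Lambda4 (- 4) \ox R_ (~~ s))%VS)%N,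
      directv (graph (- ((-1) ^+ s * (5 / 3) * i)) (Lambda3 (- 4)) +
               (Lambda4 (- 2) \ox R_ (~~ s))%VS),
      (8 <= \dim (graph (- ((-1) ^+ s * (5 / 3) * i)) (Lambda3 (- 4))))%N /\
      (7 <= \dim (Lambda4 (- 2) \ox R_ (~~ s))%VS)%N,
      (27 <= \dim (Lambda4 (2 / 3) \ox R_ s)%VS)%N &
      (48 <= \dim (graph (- ((-1) ^+ s * 10 * i)) (Lambda3 (2 / 3))))%N].
Proof.
have [L31 L32] := dim_Lambda3 K; have [L41 L42 L43 L44] := dim_Lambda4 K.
split=> [|s].
  have [_ _ dE dp dm] := zero_eigenspaces.
  have := leq_add L41 L41; rewrite -{1}dp -dm -(directvP dE : _ = _); exact.
split.
- rewrite (dim_otimesv_line (R_square _)); exact: L42.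
- exact/directv_addP/graph_otimesv_disjoint/R_square.
- rewrite dim_graph (dim_otimesv_line (R_square _)); exact: (conj L31 L43).
- rewrite (dim_otimesv_line (R_square _)); exact: L44.
- rewrite dim_graph; exact: L32.
Qed.

Definition eigenvalues : seq K :=
  0 :: flatten [seq [:: (-1) ^+ s * (36 / 5) * i; (-1) ^+ s * (18 / 5) * i;
                        (-1) ^+ s * (6 / 5) * i; (-1) ^+ s * (3 / 5) * i]
               | s : bool <- [:: false; true]].

Lemma eigenvaluesE :
  eigenvalues = map eigenvalue [:: 0; 36; 18; 6; 3; - 36; - 18; - 6; - 3].
Proof.
rewrite /eigenvalues /= !(signed_eigenvalue false) !(signed_eigenvalue true) /=.
by rewrite /eigenvalue !mul0r.
Qed.

Lemma eigenvalues_uniq : uniq eigenvalues.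
Proof. by rewrite eigenvaluesE (map_inj_uniq eigenvalue_inj). Qed.

Lemma mem_eigenvalues a : a \in eigenvalues <->
  a = 0 \/ exists s : bool,
    [\/ a = (-1) ^+ s * (36 / 5) * i, a = (-1) ^+ s * (18 / 5) * i,
        a = (-1) ^+ s * (6 / 5) * i | a = (-1) ^+ s * (3 / 5) * i].
Proof.
rewrite inE; split=> [/orP[/eqP-> | /flatten_mapP[s _]] | [-> | [s as_]]].
- by left.
- by rewrite !inE => /or4P as_; right; exists s; case: as_ => /eqP->; constructor.
- by rewrite eqxx.
apply/orP; right; apply/flatten_mapP; exists s; first by case: (s).
by rewrite !inE; case: as_ => ->; rewrite eqxx ?orbT.
Qed.

(** Since 70 + 2 (1 + 15 + 27 + 48) = 252, the lower bounds exhaust the total: each is an equality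
    and nothing remains for [n]. *)
Lemma eigenvalue_count (d : K -> nat) n (a b c e : bool -> K) :
  (n + \sum_(x <- 0%R :: flatten [seq [:: a s; b s; c s; e s] | s <- [:: false; true]]) d x
    <= 252)%N ->
  (70 <= d 0%R)%N ->
  (forall s, [/\ (1 <= d (a s))%N, (15 <= d (b s))%N, (27 <= d (c s))%N &
                 (48 <= d (e s))%N]) ->
  [/\ n = 0%N, d 0%R = 70%N &
      forall s, [/\ d (a s) = 1%N, d (b s) = 15%N, d (c s) = 27%N & d (e s) = 48%N]].
Proof.
rewrite /= !big_cons big_nil => le d0 ds; have [a0 b0 c0 e0] := ds false.
have [a1 b1 c1 e1] := ds true; split; [lia | lia |].
by case; split; lia.
Qed.

Lemma dim_eigenspaces_ge :
  (70 <= \dim (E 0))%N /\ forall s : bool,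
  [/\ (1 <= \dim (E ((-1) ^+ s * (36 / 5) * i)))%N,
      (15 <= \dim (E ((-1) ^+ s * (18 / 5) * i)))%N,
      (27 <= \dim (E ((-1) ^+ s * (6 / 5) * i)))%N &
      (48 <= \dim (E ((-1) ^+ s * (3 / 5) * i)))%N].
Proof.
have [d0 ds] := dim_claimed; have [sp sm _ _ _] := zero_eigenspaces; split=> [|s].
  apply: leq_trans d0 (dimvS _); rewrite subv_add; apply/andP; split; [exact: sp | exact: sm].
have [s1 s2 s3 s4] := signed_eigenspaces s; have [d1 dGH [dG dH] d3 d4] := ds s.
split; [exact: leq_trans d1 (dimvS s1) | | exact: leq_trans d3 (dimvS s3)
  | exact: leq_trans d4 (dimvS s4)].
apply: leq_trans (dimvS s2); rewrite (directvP dGH : _ = _) /=.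
exact: (leq_add dG dH).
Qed.

(** A hypothetical further eigenvalue [x] is adjoined to the nine, and the same count annihilates
    its eigenspace. *)
Lemma dim_eigenspaces x : x \notin eigenvalues ->
  [/\ \dim (E x) = 0%N, \dim (E 0) = 70%N & forall s : bool,
    [/\ \dim (E ((-1) ^+ s * (36 / 5) * i)) = 1%N,
        \dim (E ((-1) ^+ s * (18 / 5) * i)) = 15%N,
        \dim (E ((-1) ^+ s * (6 / 5) * i)) = 27%N &
        \dim (E ((-1) ^+ s * (3 / 5) * i)) = 48%N]].
Proof.
move=> xl; have [d0 ds] := dim_eigenspaces_ge.
apply: (eigenvalue_count (d := fun a => \dim (E a)) _ d0 ds).
have ul : uniq (x :: eigenvalues) by rewrite cons_uniq xl eigenvalues_uniq.
by have le := dim_eigenspaces_le ul; rewrite big_cons in le; apply: le.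
Qed.

Lemma leigenvalue_b_hat a : passmx.leigenvalue (@b_hat K) a <->
  a = 0 \/ exists s : bool,
    [\/ a = (-1) ^+ s * (36 / 5) * i, a = (-1) ^+ s * (18 / 5) * i,
        a = (-1) ^+ s * (6 / 5) * i | a = (-1) ^+ s * (3 / 5) * i].
Proof.
rewrite -mem_eigenvalues /passmx.leigenvalue -dimv_eq0; split=> [Ea | al].
  by apply: contraR Ea => /dim_eigenspaces[Ea0 _ _]; apply/eqP; exact: Ea0.
have [d0 ds] := dim_eigenspaces_ge; rewrite -lt0n.
have {al} /mem_eigenvalues[-> | [s]] := al; first exact: leq_trans d0.
have [d1 d2 d3 d4] := ds s.
by case=> ->; [exact: leq_trans d1 | exact: leq_trans d2 | exact: leq_trans d3
  | exact: leq_trans d4].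
Qed.

Lemma dim_eigenspacesE :
  \dim (E 0) = 70%N /\ forall s : bool,
  [/\ \dim (E ((-1) ^+ s * (36 / 5) * i)) = 1%N,
      \dim (E ((-1) ^+ s * (18 / 5) * i)) = 15%N,
      \dim (E ((-1) ^+ s * (6 / 5) * i)) = 27%N &
      \dim (E ((-1) ^+ s * (3 / 5) * i)) = 48%N].
Proof.
(* Any value off the list can instantiate [x]; i/5 is one. *)
have l1 : eigenvalue 1 \notin eigenvalues.
  by rewrite eigenvaluesE (mem_map eigenvalue_inj).
by have [_ d0 ds] := dim_eigenspaces l1.
Qed.

Lemma eq_of_dim (V : vectType K) (U W : {vspace V}) n :
  (U <= W)%VS -> (n <= \dim U)%N -> \dim W = n -> W = U.
Proof. by move=> UW nU Wn; apply/esym/eqP; rewrite eqEdim UW Wn. Qed.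

Lemma zero_eigenspace :
  let Ep := (Lambda4 0 \ox R_ false)%VS : {vspace kform K 10 5} in
  let Em := (Lambda4 0 \ox R_ true)%VS : {vspace kform K 10 5} in
  [/\ E 0 = (Ep + Em)%VS, directv (Ep + Em), \dim Ep = 35%N, \dim Em = 35%N
    & \dim (E 0) = 70%N].
Proof.
move=> Ep Em; have [sp sm dE dp dm] := zero_eigenspaces.
have [d0 _] := dim_eigenspacesE; have [d70 _] := dim_claimed.
have s0 : (Ep + Em <= E 0)%VS by rewrite subv_add; apply/andP; split; [exact: sp | exact: sm].
have e0 := eq_of_dim s0 d70 d0.
(* Both summands have the dimension of Lambda^4_(0), so the total 70 splits as 35 + 35. *)
have d35 : (\dim (Lambda4 (0 : K)) + \dim (Lambda4 (0 : K)) = 70)%N.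
  by rewrite -{1}dp -dm -(directvP dE : _ = _) -d0 e0.
have {}d35 : \dim (Lambda4 (0 : K)) = 35%N by move: d35; move: (\dim _) => n; lia.
by split; [exact: e0 | exact: dE | rewrite dp; exact: d35 | rewrite dm; exact: d35 | exact: d0].
Qed.

Lemma signed_eigenspacesE (s : bool) :
  [/\ E ((-1) ^+ s * (36 / 5) * i) = (Lambda4 (- 4)%R \ox R_ (~~ s))%VS
      /\ \dim (E ((-1) ^+ s * (36 / 5) * i)) = 1%N
    , let G := graph (- ((-1) ^+ s * (5 / 3) * i)) (Lambda3 (- 4)) in
      let H := (Lambda4 (- 2)%R \ox R_ (~~ s))%VS : {vspace kform K 10 5} in
      [/\ E ((-1) ^+ s * (18 / 5) * i) = (G + H)%VS, directv (G + H),
          \dim G = 8%N, \dim H = 7%N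
        & \dim (E ((-1) ^+ s * (18 / 5) * i)) = 15%N]
    , E ((-1) ^+ s * (6 / 5) * i) = (Lambda4 (2 / 3)%R \ox R_ s)%VS
      /\ \dim (E ((-1) ^+ s * (6 / 5) * i)) = 27%N
    & E ((-1) ^+ s * (3 / 5) * i) =
        graph (- ((-1) ^+ s * 10 * i)) (Lambda3 (2 / 3))
      /\ \dim (E ((-1) ^+ s * (3 / 5) * i)) = 48%N].
Proof.
have [_ /(_ s)[d1 d2 d3 d4]] := dim_eigenspacesE.
have [_ /(_ s)[c1 dGH [cG cH] c3 c4]] := dim_claimed.
have [s1 s2 s3 s4] := signed_eigenspaces s.
split; [split; [exact: eq_of_dim s1 c1 d1 | exact: d1] | move=> G H
  | split; [exact: eq_of_dim s3 c3 d3 | exact: d3]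
  | split; [exact: eq_of_dim s4 c4 d4 | exact: d4]].
have dGHE : \dim (G + H)%VS = (\dim G + \dim H)%N := directvP dGH.
have c15 : (15 <= \dim (G + H)%VS)%N by rewrite dGHE; exact: leq_add cG cH.
have e2 := eq_of_dim s2 c15 d2.
have e15 : (\dim G + \dim H = 15)%N by rewrite -dGHE -e2; exact: d2.
have split15 m n : (8 <= m -> 7 <= n -> m + n = 15 -> m = 8 /\ n = 7)%N by lia.
by have [dG dH] := split15 _ _ cG cH e15; split; [exact: e2 | exact: dGH | exact: dG | exact: dH | exact: d2].
Qed.

End Count.

Theorem proposition3p8 (R : realType) :
  let L50 := (({:kform R 8 5} \ox {:kform R 2 0})%VS : {vspace kform R 10 5}) in
  let L41 := (({:kform R 8 4} \ox {:kform R 2 1})%VS : {vspace kform R 10 5}) in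
  let L32 := (({:kform R 8 3} \ox {:kform R 2 2})%VS : {vspace kform R 10 5}) in
  let i : R[i] := 'i%C in
  let L3 (beta : R[i]) : {vspace kform R[i] 8 3} := Lambda3 beta in
  let L4 (beta : R[i]) : {vspace kform R[i] 8 4} := Lambda4 beta in
  let E (a : R[i]) : {vspace kform R[i] 10 5} := passmx.leigenspace b_hat a in
  [/\ directv (L50 + L41 + L32)
    , (L50 + L41 + L32)%VS = {:kform R 10 5}%VS
    & forall (F5 : kform R 8 5) (c : kform R 2 0)
             (F4 : kform R 8 4) (V : kform R 2 1)
             (F3 : kform R 8 3) (W : kform R 2 2),
      b_hat ((F5 \ox c : kform R 10 5) + (F4 \ox V : kform R 10 5)
             + (F3 \ox W : kform R 10 5)) =
        6 *: (dt_Theta F3 \ox star2 W : kform R 10 5)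
        + (9 / 5) *: (b4 F4 \ox star1 V : kform R 10 5)
        + (3 / 10) *: (d_Theta F5 \ox star0 c : kform R 10 5)]
  /\
  (forall a : R[i], passmx.leigenvalue b_hat a <->
     a = 0 \/ exists s : bool,
       [\/ a = (-1) ^+ s * (36 / 5) * i, a = (-1) ^+ s * (18 / 5) * i,
           a = (-1) ^+ s * (6 / 5) * i | a = (-1) ^+ s * (3 / 5) * i])
  /\
  (let Ep := (L4 0%R \ox R_pm R false)%VS : {vspace kform R[i] 10 5} in
   let Em := (L4 0%R \ox R_pm R true)%VS : {vspace kform R[i] 10 5} in
   [/\ E 0 = (Ep + Em)%VS, directv (Ep + Em), \dim Ep = 35%N, \dim Em = 35%N
     & \dim (E 0) = 70%N])
  /\
  (forall s : bool,
    [/\ E ((-1) ^+ s * (36 / 5) * i) = (L4 (- 4)%R \ox R_pm R (~~ s))%VS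
        /\ \dim (E ((-1) ^+ s * (36 / 5) * i)) = 1%N
      , let G := graph (- ((-1) ^+ s * (5 / 3) * i)) (L3 (- 4)) in
        let H := (L4 (- 2)%R \ox R_pm R (~~ s))%VS : {vspace kform R[i] 10 5} in
        [/\ E ((-1) ^+ s * (18 / 5) * i) = (G + H)%VS, directv (G + H),
            \dim G = 8%N, \dim H = 7%N
          & \dim (E ((-1) ^+ s * (18 / 5) * i)) = 15%N]
      , E ((-1) ^+ s * (6 / 5) * i) = (L4 (2 / 3)%R \ox R_pm R s)%VS
        /\ \dim (E ((-1) ^+ s * (6 / 5) * i)) = 27%N
      & E ((-1) ^+ s * (3 / 5) * i) =
          graph (- ((-1) ^+ s * 10 * i)) (L3 (2 / 3))
        /\ \dim (E ((-1) ^+ s * (3 / 5) * i)) = 48%N]).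
Proof.
move=> L50 L41 L32 i L3 L4 E; have ii : i * i = - 1 by rewrite -expr2 sqr_i.
split; first by have [dL eL] := block_decomposition R; split; [exact: dL | exact: eL | exact: b_hat_blocks].
split; first exact: (leigenvalue_b_hat ii).
split; first exact: (zero_eigenspace ii).
exact: (signed_eigenspacesE ii).
Qed.
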